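(* (Bogoliubov's variational principle, concave case.) Let $d\in\mathbb{N}$, $\Omega=\{1,\ldots,d\}^{\mathbb{N}}$, let $A:\Omega\to\mathbb{R}$ be a Hölder potential, let $F:\mathbb{R}\to\mathbb{R}$ be concave (hence continuous), and set $G=-F$. Assume that $\lim_{|x|\to\infty}|G^*(x)/x|=\infty$. Then the limit $\hat P(F)=\lim_{n\to\infty}\frac1n\log\int e^{nF(A_n(x))}\mu(\mathrm{d}x)$ exists and $$\hat P(F)=\inf_{s\in\mathbb{R}}\left\{G^*(-s)+P(sA)-\log d\right\}=\sup_{\rho\in\mathcal{P}(T)}\left\{F(\rho(A))+h(\rho)\right\}-\log d .$$
   Context: $T:\Omega\to\Omega$ is the shift $T(x_1,x_2,\ldots)=(x_2,x_3,\ldots)$; $\Omega$ carries the metric $d(x,y)=2^{-\min\{n:\,x_n\neq y_n\}}$, and ''Hölder'' refers to this metric. $\mathcal{P}(T)$ is the set of $T$-invariant Borel probabilities on $\Omega$; $h(\rho)$ is the Kolmogorov-Sinai entropy; $\rho(A)=\int A\,\mathrm{d}\rho$. $\mu$ is the maximal entropy probability (product measure with uniform marginals). $A_n=\frac1n(A+A\circ T+\cdots+A\circ T^{n-1})$. The linear pressure is $P(B)=\sup_{\rho\in\mathcal{P}(T)}\{\rho(B)+h(\rho)\}$. $G^*(s)=\sup_{x\in\mathbb{R}}\{sx-G(x)\}\in\mathbb{R}\cup\{\infty\}$ is the Legendre-Fenchel transform. *)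

(* Defs.v *)
From HB Require Import structures.
From mathcomp Require Import all_boot all_order all_algebra.
From mathcomp Require Import all_classical all_reals all_analysis.

Set Implicit Arguments.
Unset Strict Implicit.
Unset Printing Implicit Defensive.

Import Order.TTheory GRing.Theory Num.Theory.
Import numFieldNormedType.Exports.

Local Open Scope classical_set_scope.
Local Open Scope ring_scope.

(* The alphabet has d.+1 letters, so that it is nonempty. The parameter R is
   only the codomain of the metric. *)
Definition shift_space (R : realType) (d : nat) : Type := nat -> 'I_d.+1.

HB.instance Definition _ (R : realType) (d : nat) :=
  gen_eqMixin (shift_space R d).
HB.instance Definition _ (R : realType) (d : nat) :=
  gen_choiceMixin (shift_space R d).
HB.instance Definition _ (R : realType) (d : nat) :=
  isPointed.Build (shift_space R d) (fun=> ord0).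

(* Coordinates are counted from 1 in the formula 2^(-min{n : x_n <> y_n}),
   and from 0 here, hence the successor in the exponent. *)
Definition shift_dist (R : realType) (d : nat) (x y : shift_space R d) : R :=
  if pselect (exists n, x n != y n) is left neq then 2 ^- (ex_minn neq).+1
  else 0.

Lemma shift_distxx (R : realType) (d : nat) (x : shift_space R d) :
  shift_dist x x = 0.
Proof.
by rewrite /shift_dist; case: pselect => // h; exfalso; case: h => n; rewrite eqxx.
Qed.

Lemma shift_dist_ge0 (R : realType) (d : nat) (x y : shift_space R d) :
  0 <= shift_dist x y.
Proof.
by rewrite /shift_dist; case: pselect => // h; rewrite invr_ge0 exprn_ge0.
Qed.

Lemma shift_dist_positivity (R : realType) (d : nat) (x y : shift_space R d) :
  shift_dist x y = 0 -> x = y.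
Proof.
rewrite /shift_dist; case: pselect => [h /eqP|nh _].
  by rewrite invr_eq0 expf_eq0 /= pnatr_eq0.
by apply/funext => n; apply/eqP/negPn/negP => xyn; apply: nh; exists n.
Qed.

Lemma shift_dist_sym (R : realType) (d : nat) (x y : shift_space R d) :
  shift_dist x y = shift_dist y x.
Proof.
rewrite /shift_dist; case: pselect => [h|nh]; case: pselect => [h'|nh'] //.
- by congr (2 ^- _.+1); apply: eq_ex_minn => n; rewrite eq_sym.
- by case: nh'; case: h => n xyn; exists n; rewrite eq_sym.
- by case: nh; case: h' => n xyn; exists n; rewrite eq_sym.
Qed.

Lemma shift_dist_lower (R : realType) (d : nat) (x y : shift_space R d) n :
  x n != y n -> 2 ^- n.+1 <= shift_dist x y.
Proof.
move=> xyn; rewrite /shift_dist; case: pselect => [h|[]]; last by exists n.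
case: ex_minnP => m _ /(_ _ xyn) mn.
by rewrite lef_pV2 ?posrE ?exprn_gt0// ler_eXn2l// ltr1n.
Qed.

Lemma shift_dist_triangle (R : realType) (d : nat) (y x z : shift_space R d) :
  shift_dist x z <= shift_dist x y + shift_dist y z.
Proof.
rewrite {1}/shift_dist; case: pselect => [h|_]; last first.
  by rewrite addr_ge0 ?shift_dist_ge0.
case: ex_minnP => m xzm _.
have [xym|xym] := eqVneq (x m) (y m).
  rewrite xym in xzm.
  by rewrite (le_trans (shift_dist_lower xzm))// lerDr shift_dist_ge0.
by rewrite (le_trans (shift_dist_lower xym))// lerDl shift_dist_ge0.
Qed.

HB.instance Definition _ (R : realType) (d : nat) :=
  isMetric.Build R (shift_space R d)
    (@shift_distxx R d) (@shift_dist_positivity R d) (@shift_dist_sym R d)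
    (@shift_dist_triangle R d).

Definition borel_shift (R : realType) (d : nat) :=
  g_sigma_algebraType (@open (shift_space R d)).

Definition shift_map (R : realType) (d : nat) (x : shift_space R d) :
  shift_space R d := fun n => x n.+1.

Definition holder (R : realType) (M : metricType R) (A : M -> R) : Prop :=
  exists C alpha : R, [/\ 0 < alpha, alpha <= 1 &
    forall x y : M, `|A x - A y| <= C * mdist x y `^ alpha].

Definition concave_function (R : realType) (F : R -> R) : Prop :=
  forall x y t : R, 0 <= t -> t <= 1 ->
    t * F x + (1 - t) * F y <= F (t * x + (1 - t) * y).

Definition legendre (R : realType) (G : R -> R) (s : R) : \bar R :=
  ereal_sup (range (fun x : R => (s * x - G x)%:E)).

(* The limit as |x| -> oo is expressed as the limits at +oo and at -oo. *)
Definition superlinear (R : realType) (g : R -> \bar R) : Prop :=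
  (`|g x * (x^-1)%:E|%E @[x --> +oo] --> +oo%E) /\
  (`|g x * (x^-1)%:E|%E @[x --> -oo] --> +oo%E).

Definition invariant_probability (disp : measure_display)
    (X : measurableType disp) (R : realType) (T : X -> X) :
    set (probability X R) :=
  [set rho | forall B, measurable B -> rho (T @^-1` B) = rho B].

(* The cell of P \/ T^-1 P \/ ... \/ T^-(n-1) P with itinerary w. *)
Definition join_cell (X : Type) (T : X -> X) (k : nat) (P : 'I_k -> set X)
    (n : nat) (w : {ffun 'I_n -> 'I_k}) : set X :=
  \bigcap_(i in [set: 'I_n]) (iter i T @^-1` P (w i)).

(* Since ln 0 = 0, cells of measure 0 contribute 0. *)
Definition join_entropy (disp : measure_display) (X : measurableType disp)
    (R : realType) (T : X -> X) (rho : probability X R) (k : nat)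
    (P : 'I_k -> set X) (n : nat) : R :=
  - \sum_(w : {ffun 'I_n -> 'I_k})
      (fine (rho (join_cell T P w)) * ln (fine (rho (join_cell T P w)))).

Definition partition_entropy (disp : measure_display)
    (X : measurableType disp) (R : realType) (T : X -> X)
    (rho : probability X R) (k : nat) (P : 'I_k -> set X) : R :=
  limn (fun n : nat => n%:R^-1 * join_entropy T rho P n).

Definition ks_entropy (disp : measure_display) (X : measurableType disp)
    (R : realType) (T : X -> X) (rho : probability X R) : \bar R :=
  ereal_sup [set h | exists (k : nat) (P : 'I_k -> set X),
    [/\ forall i, measurable (P i),
        partition [set: 'I_k] P [set: X] &
        h = (partition_entropy T rho P)%:E]].

Definition pressure (disp : measure_display) (X : measurableType disp)
    (R : realType) (T : X -> X) (B : X -> R) : \bar R :=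
  ereal_sup [set ((\int[rho]_x B x)%:E + ks_entropy T rho)%E
            | rho in @invariant_probability disp X R T].

Definition birkhoff_average (X : Type) (R : realType) (T : X -> X)
    (A : X -> R) (n : nat) (x : X) : R :=
  n%:R^-1 * \sum_(i < n) A (iter i T x).

Definition uniform_product_measure (R : realType) (d : nat)
    (mu : probability (borel_shift R d) R) : Prop :=
  forall (n : nat) (B : 'I_n -> {set 'I_d.+1}),
    mu [set x : borel_shift R d | forall i : 'I_n, x i \in B i] =
    (\prod_(i < n) (#|B i|%:R / d.+1%:R))%:E.

Definition nonlinear_pressure_seq (disp : measure_display)
    (X : measurableType disp) (R : realType) (T : X -> X)
    (mu : probability X R) (A : X -> R) (F : R -> R) (n : nat) : R :=
  n%:R^-1 * ln (\int[mu]_x expR (n%:R * F (birkhoff_average T A n x))).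

Definition nonlinear_pressure (disp : measure_display)
    (X : measurableType disp) (R : realType) (T : X -> X)
    (mu : probability X R) (A : X -> R) (F : R -> R) : R :=
  limn (nonlinear_pressure_seq T mu A F).

(* Main.v *)
Require Import Defs.
From HB Require Import structures.
From mathcomp Require Import all_boot all_order all_algebra.
From mathcomp Require Import all_classical all_reals all_analysis.
From mathcomp Require Import measurable_realfun.
From mathcomp Require Import ring lra zify.

Set Implicit Arguments.
Unset Strict Implicit.
Unset Printing Implicit Defensive.

Import Order.TTheory GRing.Theory Num.Theory.
Import numFieldNormedType.Exports.

Local Open Scope classical_set_scope.
Local Open Scope ring_scope.

(** Put V for the supremum of F (rho(A)) + h(rho) over the invariant
    probabilities. The proof replaces the integral by a sum over words of length
    n, compares the growth rate of that sum with V from both sides, and then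
    obtains the dual formula from convexity in the plane.

    A Hoelder potential has bounded distortion: on the cylinder of a word w of
    length n, the exponent n F (A_n x) is constant up to an error independent of
    n, because F is Lipschitz on bounded sets. Hence n times the n-th term of
    the sequence defining the nonlinear pressure is ln Z_n - n ln (d + 1) + O(1),
    where Z_n is the sum over words of exp (n F (a_w)) and a_w is the Birkhoff
    average of A along w ([nonlinear_pressure_partition_sum]).

    Upper bound ([partition_sum_le]). By the finite Gibbs variational principle,
    ln Z_n equals n p(F(a)) + H(p), where p(F(a)) is the mean of F (a_w) for the
    Gibbs weights p, and p(F(a)) <= F(p(a)) since F is concave. Concatenating independent
    blocks of law p gives an invariant probability ([block_measure]) whose
    integral of A is p(a) + O(1 / n) and whose entropy is at least H(p) / n.
    Therefore ln Z_n <= n V + O(1).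

    Lower bound ([partition_sum_ge]). Given an invariant rho, independent copies
    of its words of length m have averages that concentrate near rho(A), whether
    or not rho is ergodic, and their entropy per letter is at least h(rho). The
    same finite variational principle then bounds ln Z_n from below by
    n (F (rho(A)) + h(rho) - o(1)). So the limit exists and equals
    V - ln (d + 1).

    Both bounds identify h(rho), a supremum over all finite measurable partitions,
    with the growth rate of the entropy of words: this is the Kolmogorov-Sinai
    theorem ([itinerary_entropy_rate_le], [ks_entropyE]).

    Duality. For all s, y and rho, G^*(-s) >= F(y) - s y and
    P(sA) >= s rho(A) + h(rho); with y = rho(A) this shows that the infimum is
    at least V - ln (d + 1). Conversely the pairs (rho(A), h(rho)) span a convex
    set ([invariant_mixture]) that lies below the graph of V - F, and a line that
    separates the two ([concave_sandwich]) has a slope s for which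
    F(y) - s y + s rho(A) + h(rho) <= V for all y and rho, that is,
    G^*(-s) + P(sA) <= V. *)

(** * Entropy of finite distributions *)

(** The convention ln 0 = 0 makes the atoms of mass zero contribute nothing. *)
Definition entropy (R : realType) (I : finType) (p : I -> R) : R :=
  - \sum_i p i * ln (p i).

(** Termwise, p ln (q / p) <= p (q / p - 1) = q - p, and the right-hand sides
    sum to a nonpositive number. Most entropy estimates below are instances of
    this inequality for a well chosen q. *)
Lemma gibbs (R : realType) (I : finType) (p q : I -> R) :
  (forall i, 0 <= p i) -> (forall i, 0 <= q i) ->
  (forall i, 0 < p i -> 0 < q i) -> \sum_i q i <= \sum_i p i ->
  \sum_i p i * ln (q i) <= \sum_i p i * ln (p i).
Proof.
move=> p0 q0 pq sqp; rewrite -subr_le0 -sumrB.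
apply: (@le_trans _ _ (\sum_i (q i - p i))); last by rewrite sumrB subr_le0.
apply: ler_sum => i _; have := p0 i; rewrite le_eqVlt => /predU1P[<-|pi0].
  by rewrite !mul0r subrr subr0.
have qi0 := pq i pi0.
rewrite -mulrBr -ln_div ?posrE//.
have -> : q i - p i = p i * (q i / p i - 1).
  by rewrite mulrBr mulr1 mulrC divfK// gt_eqF.
rewrite ler_pM2l//.
have {1}-> : q i / p i = 1 + (q i / p i - 1) by ring.
by apply: le_ln1Dx; rewrite ltrBrDr addNr divr_gt0.
Qed.

Lemma entropy_le_cross (R : realType) (I : finType) (p q : I -> R) :
  (forall i, 0 <= p i) -> (forall i, 0 <= q i) ->
  (forall i, 0 < p i -> 0 < q i) -> \sum_i q i <= \sum_i p i ->
  entropy p <= - \sum_i p i * ln (q i).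
Proof. by move=> *; rewrite lerN2 gibbs. Qed.

(** The inequality [gibbs] against the weights exp f / Z: the finite
    variational principle, whose case of equality is [entropy_gibbs_measure].
    *)
Lemma entropy_le_energy (R : realType) (I : finType) (p f : I -> R) :
  (forall i, 0 <= p i) -> \sum_i p i = 1 ->
  \sum_i p i * f i + entropy p <= ln (\sum_i expR (f i)).
Proof.
move=> p0 p1; set Z := \sum_i expR (f i).
have Z0 : 0 < Z.
  have /existsP[i _] : [exists i, p i != 0].
    apply: contra_eqT p1; rewrite negb_exists => /forallP h.
    rewrite big1 ?(eq_sym 0) ?oner_eq0// => i _.
    by have := h i; rewrite negbK => /eqP.
  rewrite /Z (bigD1 i)//= ltr_pwDl ?expR_gt0//.
  by apply: sumr_ge0 => j _; exact: expR_ge0.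
have := @entropy_le_cross _ _ p (fun i => expR (f i) / Z) p0.
rewrite -mulr_suml -/Z divff ?gt_eqF// p1 => /(_ _ _ (lexx _)) h.
rewrite -lerBrDl (le_trans (h _ _))//.
- by move=> i; rewrite divr_ge0 ?expR_ge0// ltW.
- by move=> i _; rewrite divr_gt0 ?expR_gt0.
rewrite (eq_bigr (fun i => p i * f i - p i * ln Z)); last first.
  by move=> i _; rewrite ln_div ?posrE ?expR_gt0// expRK mulrBr.
by rewrite sumrB -mulr_suml p1 mul1r opprB.
Qed.

Lemma entropy_gibbs_measure (R : realType) (I : finType) (f : I -> R) (i0 : I)
    (Z := \sum_i expR (f i)) (p := fun i => expR (f i) / Z) :
  [/\ forall i, 0 <= p i, \sum_i p i = 1 &
      ln Z = \sum_i p i * f i + entropy p].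
Proof.
have Z0 : 0 < Z.
  rewrite /Z (bigD1 i0)//= ltr_pwDl ?expR_gt0//.
  by apply: sumr_ge0 => j _; exact: expR_ge0.
have p1 : \sum_i p i = 1 by rewrite /p -mulr_suml divff ?gt_eqF.
split => //; first by move=> i; rewrite divr_ge0 ?expR_ge0// ltW.
rewrite /entropy (eq_bigr (fun i => p i * f i)) // -sumrB.
rewrite (eq_bigr (fun i => p i * ln Z)); first by rewrite -mulr_suml p1 mul1r.
move=> i _; have -> : ln (p i) = f i - ln Z.
  by rewrite ln_div ?posrE ?expR_gt0// expRK.
ring.
Qed.

Lemma entropy_ge0 (R : realType) (I : finType) (p : I -> R) :
  (forall i, 0 <= p i) -> \sum_i p i = 1 -> 0 <= entropy p.
Proof.
move=> p0 p1; rewrite oppr_ge0; apply: sumr_le0 => i _.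
apply: mulr_ge0_le0 => //; apply: ln_le0.
by rewrite -p1 (bigD1 i)//= lerDl sumr_ge0.
Qed.

Lemma entropy_le_card (R : realType) (I : finType) (p : I -> R) :
  (forall i, 0 <= p i) -> \sum_i p i = 1 -> entropy p <= ln #|I|%:R.
Proof.
move=> p0 p1; have := entropy_le_energy (fun=> 0) p0 p1.
rewrite big1 ?add0r; last by move=> *; rewrite mulr0.
by rewrite expR0 sumr_const.
Qed.

(** Each p j is compared, by [gibbs], with the mixture itself. *)
Lemma entropy_concave (R : realType) (I J : finType) (c : J -> R)
    (p : J -> I -> R) :
  (forall j, 0 <= c j) -> \sum_j c j = 1 ->
  (forall j i, 0 <= p j i) -> (forall j, \sum_i p j i = 1) ->
  \sum_j c j * entropy (p j) <= entropy (fun i => \sum_j c j * p j i).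
Proof.
move=> c0 c1 p0 p1; set q := (X in _ <= entropy X).
have q0 i : 0 <= q i by apply: sumr_ge0 => j _; rewrite mulr_ge0.
have q1 : \sum_i q i = 1.
  rewrite exchange_big/= -c1; apply: eq_bigr => j _.
  by rewrite -mulr_sumr p1 mulr1.
have -> : entropy q = \sum_j c j * - \sum_i p j i * ln (q i).
  rewrite /entropy -sumrN; under [RHS]eq_bigr do rewrite -sumrN mulr_sumr.
  rewrite exchange_big/=; apply: eq_bigr => i _.
  by rewrite {1}/q mulr_suml -sumrN; apply: eq_bigr => j _; ring.
apply: ler_sum => j _; have := c0 j; rewrite le_eqVlt => /predU1P[<-|cj0].
  by rewrite !mul0r.
rewrite ler_pM2l//; apply: entropy_le_cross => //; last by rewrite q1 p1.
move=> i pij; rewrite /q (bigD1 j)//= ltr_pwDl ?mulr_gt0//.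
by apply: sumr_ge0 => k _; rewrite mulr_ge0.
Qed.

(** * Laws of finite-valued measurable maps *)

Definition finite_valued_measurable (disp : measure_display)
    (X : measurableType disp) (I : Type) (Y : X -> I) : Prop :=
  forall i, measurable (Y @^-1` [set i]).

Definition law (disp : measure_display) (X : measurableType disp)
    (R : realType) (P : probability X R) (I : finType) (Y : X -> I) : I -> R :=
  fun i => fine (P (Y @^-1` [set i])).

Section finite_laws.
Context {disp : measure_display} {X : measurableType disp} {R : realType}.
Variable P : probability X R.
Local Notation fvm := (@finite_valued_measurable _ X _).

Lemma fvm_preimage (I : finType) (Y : X -> I) (A : set I) :
  fvm Y -> measurable (Y @^-1` A).
Proof.
move=> mY.
have -> : Y @^-1` A = \bigcup_(i in A) (Y @^-1` [set i]).
  apply/seteqP; split => [x Ax|x [i Ai /= Yx]].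
    by exists (Y x).
  by rewrite /preimage/= Yx.
by apply: fin_bigcup_measurable => //; exact: finite_finset.
Qed.

Lemma fvm_comp (I J : finType) (Y : X -> I) (g : I -> J) :
  fvm Y -> fvm (g \o Y).
Proof. by move=> mY j; rewrite comp_preimage; exact: fvm_preimage. Qed.

Lemma fvm_pair (I J : finType) (Y : X -> I) (Z : X -> J) :
  fvm Y -> fvm Z -> fvm (fun x => (Y x, Z x)).
Proof.
move=> mY mZ [i j].
have -> : (fun x => (Y x, Z x)) @^-1` [set (i, j)] =
    Y @^-1` [set i] `&` Z @^-1` [set j].
  by apply/seteqP; split => x /= => [[]|[-> ->]].
exact: measurableI.
Qed.

Lemma fvm_ffun (I J : finType) (Y : I -> X -> J) :
  (forall i, fvm (Y i)) -> fvm (fun x => [ffun i => Y i x]).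
Proof.
move=> mY w.
have -> : (fun x => [ffun i => Y i x]) @^-1` [set w] =
    \bigcap_(i in [set: I]) (Y i @^-1` [set w i]).
  apply/seteqP; split => x /=.
    by move=> <- i _; rewrite /= ffunE.
  by move=> h; apply/ffunP => i; rewrite ffunE; exact: h.
by apply: fin_bigcap_measurable => // i _; exact: mY.
Qed.

Lemma law_ge0 (I : finType) (Y : X -> I) i : 0 <= law P Y i.
Proof. by rewrite fine_ge0. Qed.

Lemma fin_num_probability A : measurable A -> P A \is a fin_num.
Proof. exact: fin_num_measure. Qed.

Lemma integrable_fvm (I : finType) (Y : X -> I) (phi : I -> R) :
  fvm Y -> P.-integrable setT (EFin \o (phi \o Y)).
Proof.
move=> mY; apply: measurable_bounded_integrable => //.
- exact: (le_lt_trans (probability_le1 P measurableT) (ltry _)).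
- move=> _ B _; rewrite setTI comp_preimage; exact: fvm_preimage.
- exists (\sum_i `|phi i|); split; first exact: num_real.
  move=> M /ltW sM x _ /=; apply: le_trans sM.
  by rewrite (bigD1 (Y x))//= lerDl sumr_ge0.
Qed.

Lemma Rintegral_law (I : finType) (Y : X -> I) (phi : I -> R) :
  fvm Y -> \int[P]_x phi (Y x) = \sum_i law P Y i * phi i.
Proof.
move=> mY; rewrite /Rintegral.
rewrite (eq_integral (fun x =>
  \sum_i ((phi i)%:E * (\1_(Y @^-1` [set i]) x)%:E))%E); last first.
  move=> x _; rewrite (bigD1 (Y x))//= big1 ?adde0.
    by rewrite indicE mem_set// mule1.
  move=> i iY; rewrite indicE memNset ?mule0//=.
  by move=> /esym/eqP; rewrite (negbTE iY).
rewrite integral_sum//; last first.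
  move=> i; apply: integrableZl => //; exact: integrable_indic.
have int1 i : (\int[P]_x (\1_(Y @^-1` [set i]) x)%:E = (law P Y i)%:E)%E.
  by rewrite integral_indic// setIT /law fineK// fin_num_probability.
under eq_bigr => i _.
  rewrite integralZl//; last exact: integrable_indic.
  rewrite int1 -EFinM mulrC; over.
by rewrite sumEFin.
Qed.

Lemma sum_law (I : finType) (Y : X -> I) : fvm Y -> \sum_i law P Y i = 1.
Proof.
move=> mY; under eq_bigr do rewrite -[law _ _ _]mulr1.
rewrite -(Rintegral_law (fun=> 1) mY) Rintegral_cst// mul1r.
exact: (congr1 fine (probability_setT P)).
Qed.

(** Change of variables: both sides are the integral of phi o g o Y. *)
Lemma law_map (I J : finType) (Y : X -> I) (g : I -> J) (phi : J -> R) :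
  fvm Y ->
  \sum_j law P (g \o Y) j * phi j = \sum_i law P Y i * phi (g i).
Proof.
move=> mY; rewrite -Rintegral_law; last exact: fvm_comp.
by rewrite -(Rintegral_law (phi \o g)).
Qed.

Lemma law_comp (I J : finType) (Y : X -> I) (g : I -> J) j : fvm Y ->
  law P (g \o Y) j = \sum_(i | g i == j) law P Y i.
Proof.
move=> mY; have := law_map g (fun k => (k == j)%:R) mY.
rewrite (bigD1 j)//= eqxx mulr1 big1 ?addr0; last first.
  by move=> k /negbTE ->; rewrite mulr0.
move=> ->; rewrite [RHS]big_mkcond/=; apply: eq_bigr => i _.
by case: eqP => _; rewrite (mulr1, mulr0).
Qed.

Lemma law_le_comp (I J : finType) (Y : X -> I) (g : I -> J) i : fvm Y ->
  law P Y i <= law P (g \o Y) (g i).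
Proof.
move=> mY; rewrite law_comp// (bigD1 i)//= lerDl sumr_ge0// => j _.
exact: law_ge0.
Qed.

(** A function of Y is less informative than Y, because the event Y = i is
    contained in the event g o Y = g i. *)
Lemma entropy_law_comp (I J : finType) (Y : X -> I) (g : I -> J) : fvm Y ->
  entropy (law P (g \o Y)) <= entropy (law P Y).
Proof.
move=> mY; rewrite lerN2 law_map//; apply: ler_sum => i _.
have := law_ge0 Y i; rewrite le_eqVlt => /predU1P[<-|h]; first by rewrite !mul0r.
have h' := law_le_comp g i mY.
by rewrite ler_pM2l// ler_ln ?posrE// (lt_le_trans h).
Qed.

Lemma entropy_law_ge0 (I : finType) (Y : X -> I) :
  fvm Y -> 0 <= entropy (law P Y).
Proof. by move=> mY; apply: entropy_ge0; [exact: law_ge0|exact: sum_law]. Qed.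

(** Observables that are uniformly close to a finite-valued one are integrated
    through finite sums. All the integrals of the potential are handled this
    way, so that invariance, linearity in the measure and changes of variables
    reduce to statements about laws of words. *)
Lemma ler_norm_Rintegral_law (I : finType) (Y : X -> I) (f : X -> R)
    (phi : I -> R) (e : R) : fvm Y -> measurable_fun setT f ->
  (forall x, `|f x - phi (Y x)| <= e) ->
  `|\int[P]_x f x - \sum_i law P Y i * phi i| <= e.
Proof.
move=> mY mf fe.
have If : P.-integrable setT (EFin \o f).
  apply: measurable_bounded_integrable => //.
    exact: (le_lt_trans (probability_le1 P measurableT) (ltry _)).
  exists (\sum_i `|phi i| + e); split; first exact: num_real.
  move=> M /ltW sM x _ /=; apply: le_trans sM.
  rewrite (le_trans (_ : _ <= `|phi (Y x)| + `|f x - phi (Y x)|))//.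
    by rewrite -{1}[f x](subrK (phi (Y x))) addrC ler_normD.
  by rewrite lerD// (bigD1 (Y x))//= lerDl sumr_ge0.
have Ip c : P.-integrable setT (EFin \o (fun x => phi (Y x) + c)).
  exact: (@integrable_fvm _ Y (fun i => phi i + c)).
have Ic c : \int[P]_x (phi (Y x) + c) = \sum_i law P Y i * phi i + c.
  rewrite (Rintegral_law (fun i => phi i + c) mY).
  under eq_bigr do rewrite mulrDr.
  by rewrite big_split/= -mulr_suml sum_law// mul1r.
rewrite ler_norml; apply/andP; split.
  rewrite lerBrDl -Ic; apply: le_Rintegral => // x _.
  by have := fe x; rewrite ler_norml => /andP[+ _]; rewrite lerBrDl.
rewrite lerBlDl -Ic; apply: le_Rintegral => // x _.
by have := fe x; rewrite ler_norml => /andP[_]; rewrite lerBlDl.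
Qed.

End finite_laws.

(** * Cylinders and the Borel sigma-algebra of the shift space *)

Section shift_space_measurability.
Context {R : realType} {d : nat}.
Local Notation Om := (borel_shift R d).
Local Notation T := (@shift_map R d : Om -> Om).
Local Notation fvm := (@finite_valued_measurable _ _ _).

Definition word (n : nat) (x : Om) : {ffun 'I_n -> 'I_d.+1} := [ffun i : 'I_n => x i].

Lemma iter_shift (k n : nat) (x : Om) : iter k T x n = x (k + n)%N.
Proof.
elim: k n => [//|k IH] n; rewrite iterS /shift_map IH.
by rewrite addnS.
Qed.

Lemma word_eqP n (x y : Om) :
  word n x = word n y <-> forall i, (i < n)%N -> x i = y i.
Proof.
split => [/ffunP h i ni|h]; first by have := h (Ordinal ni); rewrite !ffunE.
by apply/ffunP => i; rewrite !ffunE h.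
Qed.

Lemma word_eq_le m n (x y : Om) :
  (m <= n)%N -> word n x = word n y -> word m x = word m y.
Proof.
move=> mn /word_eqP h; apply/word_eqP => i im; apply: h.
exact: leq_trans mn.
Qed.

(** Words are indexed from 0, so agreement on n letters puts the first
    disagreement at index n or later, that is, the distance at most 2^-(n+1).
    *)
Lemma shift_dist_word n (x y : shift_space R d) :
  word n x = word n y -> shift_dist x y <= 2 ^- n.+1.
Proof.
move=> /word_eqP xy; rewrite /shift_dist; case: pselect => [h|_]; last first.
  by rewrite invr_ge0 exprn_ge0.
case: ex_minnP => m xym _.
rewrite lef_pV2 ?posrE ?exprn_gt0// ler_eXn2l// ?ltr1n// ltnS leqNgt.
by apply/negP => /xy xyE; rewrite xyE eqxx in xym.
Qed.

Lemma geometric_lt (r e : R) : 0 <= r -> r < 1 -> 0 < e -> exists n, r ^+ n < e.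
Proof.
move=> r0 r1 e0.
have : r ^+ n @[n --> \oo] --> 0 by apply: cvg_expr; rewrite ger0_norm.
move=> /cvgrPdist_lt /(_ e e0)[n _ /(_ n (leqnn n))].
by rewrite /= sub0r normrN ger0_norm ?exprn_ge0//; exists n.
Qed.

Lemma open_local (U : set (shift_space R d)) x : open U -> U x ->
  exists n, forall y : Om, word n y = word n x -> U y.
Proof.
move=> oU Ux; have /nbhs_ballP[e /= e0 eU] : nbhs x U by exact: open_nbhs_nbhs.
have [n ne] := @geometric_lt 2^-1 e ltac:(lra) ltac:(lra) e0.
exists n => y yx; apply: eU; rewrite ballEmdist /=.
apply: le_lt_trans ne; rewrite exprVn.
apply: (le_trans (shift_dist_word (esym yx))).
by rewrite lef_pV2 ?posrE ?exprn_gt0// ler_eXn2l// ltr1n.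
Qed.

Lemma fvm_coord i : fvm (fun x : Om => x i).
Proof.
move=> a; apply: sub_sigma_algebra.
rewrite openE => x /= xa; apply/nbhs_ballP.
exists (2 ^- i.+1) => /=; first by rewrite invr_gt0 exprn_gt0.
move=> y; rewrite ballEmdist /= => xy.
apply/eqP; rewrite -xa eq_sym; apply: contraLR xy => /(@shift_dist_lower R).
by rewrite -leNgt.
Qed.

Lemma fvm_word n : fvm (word n).
Proof. by apply: fvm_ffun => i; exact: fvm_coord. Qed.

(** A set is open for the metric exactly when membership of each of its points
    is decided by a finite prefix; there are countably many words, so such a
    set is a countable union of cylinders. *)
Lemma local_bigcup (U : set Om) :
  (forall x, U x -> exists n, forall y, word n y = word n x -> U y) ->
  U = \bigcup_n (word n @^-1` [set w | forall y, word n y = w -> U y]).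
Proof.
move=> lU; apply/seteqP; split => [x /lU[n h]|x [n _ h]]; last exact: h.
by exists n.
Qed.

Lemma measurable_local (U : set Om) :
  (forall x, U x -> exists n, forall y, word n y = word n x -> U y) ->
  measurable U.
Proof.
move=> /local_bigcup ->; apply: bigcupT_measurable => n.
by apply: fvm_preimage; exact: fvm_word.
Qed.

Lemma measurable_fun_local (f : Om -> R) :
  (forall x e, 0 < e ->
     exists n, forall y, word n y = word n x -> `|f y - f x| < e) ->
  measurable_fun setT f.
Proof.
move=> lf; apply: (measurability _ (RGenOInfty.measurableE R)) => _ [_ [r ->] <-].
rewrite setTI; apply: measurable_local => x /=; rewrite in_itv/= andbT => rx.
have /(lf x)[n fn] : 0 < f x - r by rewrite subr_gt0.
exists n => y /fn; rewrite ltr_norml => /andP[+ _] /=; rewrite in_itv/= andbT.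
lra.
Qed.

Definition cylinders : set (set Om) :=
  [set B | exists (n : nat) (S : set {ffun 'I_n -> 'I_d.+1}), B = word n @^-1` S].

(** A cylinder over n letters is a cylinder over any m >= n letters. The base
    is described through the points that extend a word, which avoids truncating
    words. *)
Lemma cylinder_local n (S : set {ffun 'I_n -> 'I_d.+1}) m : (n <= m)%N ->
  word n @^-1` S = word m @^-1` [set w | forall y, word m y = w -> S (word n y)].
Proof.
move=> nm; apply/seteqP; split => x /=; last exact.
by move=> Sx y /(word_eq_le nm) ->.
Qed.

Lemma setI_closed_cylinders : setI_closed cylinders.
Proof.
move=> _ _ [n [S ->]] [m [S' ->]].
rewrite (cylinder_local S (leq_maxl n m)) (cylinder_local S' (leq_maxr n m)).
by rewrite -preimage_setI; exists (maxn n m); eexists.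
Qed.

Lemma measurable_cylinders : @measurable _ Om = <<s cylinders >>.
Proof.
apply/seteqP; split.
  apply: smallest_sub; first exact: smallest_sigma_algebra.
  move=> U oU; have /local_bigcup -> : forall x, U x ->
      exists n, forall y : Om, word n y = word n x -> U y.
    by move=> x; exact: open_local.
  apply: (@bigcupT_measurable _ (g_sigma_algebraType cylinders)) => n.
  by apply: sub_sigma_algebra; exists n; eexists.
apply: smallest_sub; first exact: sigma_algebra_measurable.
move=> _ [n [S ->]]; apply: fvm_preimage; exact: fvm_word.
Qed.

(** Cylinders form a pi-system that generates the Borel sets. *)
Lemma shift_measure_unique (P Q : probability Om R) :
  (forall n w, law P (word n) w = law Q (word n) w) ->
  forall B, measurable B -> P B = Q B.
Proof.
move=> PQ B mB.
apply: (measure_unique cylinders (fun=> setT)) => //.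
- exact: measurable_cylinders.
- exact: setI_closed_cylinders.
- by move=> _; exists 0%N, setT; rewrite preimage_setT.
- by rewrite bigcup_const//; exists 0%N.
- move=> _ [n [S ->]].
  have eqS (P' : probability Om R) : P' (word n @^-1` S) =
      (\sum_(w | w \in S) law P' (word n) w)%:E.
    have := law_comp P' (fun w => w \in S) true (@fvm_word n).
    have E : ((fun w => w \in S) \o word n) @^-1` [set true] = word n @^-1` S.
      by apply/seteqP; split => x /= => [/set_mem|/mem_set].
    rewrite {1}/law E (eq_bigl (fun w => w \in S)) => [<-|w]; last by rewrite eqb_id.
   
    rewrite fineK// fin_num_probability//; apply: fvm_preimage; exact: fvm_word.
  apply: etrans (eqS P) (etrans _ (esym (eqS Q))).
  by congr EFin; apply: eq_bigr => w _; exact: PQ.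
- by move=> _; exact: (le_lt_trans (probability_le1 P measurableT) (ltry _)).
Qed.

Lemma measurable_fun_shift_space (disp : measure_display)
    (X : measurableType disp) (f : X -> Om) :
  (forall i, fvm (fun x => f x i)) -> measurable_fun setT f.
Proof.
move=> mf; apply: (measurability _ measurable_cylinders) => _ [_ [n [S ->]] <-].
rewrite setTI -comp_preimage; apply: fvm_preimage; apply: fvm_ffun => i.
exact: mf.
Qed.

Lemma measurable_shift : measurable_fun setT T.
Proof. by apply: measurable_fun_shift_space => i; exact: fvm_coord. Qed.

Lemma measurable_iter_shift k : measurable_fun setT (iter k T).
Proof.
apply: measurable_fun_shift_space => i.
have -> : (fun x => iter k T x i) = (fun x : Om => x (k + i)%N).
  by apply/funext => x; rewrite iter_shift.
exact: fvm_coord.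
Qed.

Lemma fvm_iter_shift (I : finType) (Y : Om -> I) k : fvm Y -> fvm (Y \o iter k T).
Proof.
move=> mY i; rewrite comp_preimage -[X in measurable X]setTI.
exact: measurable_iter_shift.
Qed.

Lemma law_iter_shift (rho : probability Om R) (I : finType) (Y : Om -> I) k :
  invariant_probability T rho -> fvm Y -> law rho (Y \o iter k T) = law rho Y.
Proof.
move=> inv mY; apply/funext => i; rewrite /law; congr fine.
elim: k => [//|k IH].
have -> : (Y \o iter k.+1 T) @^-1` [set i] = T @^-1` ((Y \o iter k T) @^-1` [set i]).
  by apply/seteqP; split => x /=; rewrite -iterSr.
by rewrite inv//; exact: fvm_iter_shift.
Qed.

End shift_space_measurability.

(** * Subadditive sequences and concave functions of one real variable *)

(** The limit is the infimum of u n / n over n > 0: writing n = q m + r gives u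
    n <= q u m + C with C independent of n, and m is chosen nearly optimal. *)
Lemma fekete (R : realType) (u : nat -> R) :
  (forall n, 0 <= u n) -> (forall m n, u (m + n)%N <= u m + u n) ->
  exists2 l : R, n%:R^-1 * u n @[n --> \oo] --> l &
    forall n, (0 < n)%N -> n%:R * l <= u n.
Proof.
move=> u0 uD.
pose S := [set v | exists2 n, (0 < n)%N & v = u n / n%:R].
have S0 : has_inf S.
  split; first by exists (u 1%N / 1%:R), 1%N.
  by exists 0 => _ [n _ ->]; rewrite divr_ge0.
have lbS n : (0 < n)%N -> n%:R * inf S <= u n.
  move=> n0; rewrite mulrC -ler_pdivlMr ?ltr0n//.
  by apply: ge_inf; [case: S0|exists n].
exists (inf S) => //.
have uM m q r : u (q * m + r)%N <= q%:R * u m + u r.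
  elim: q => [|q IH]; first by rewrite mul0n mul0r add0r.
  rewrite mulSn -addnA (le_trans (uD _ _))// -natr1 mulrDl mul1r.
  by rewrite -addrA addrCA lerD2l.
apply/cvgrPdist_le => e e0.
have [_ [m m0 ->] ume] := inf_adherent (divr_gt0 e0 (ltr0Sn R 1)) S0.
pose C := u 0%N + m%:R * u 1%N.
have C0 : 0 <= C by rewrite addr_ge0// mulr_ge0.
have [N NC] : exists N, C / (e / 2) < N%:R.
  by exists (Num.bound (C / (e / 2))); apply: archi_boundP; rewrite divr_ge0// ltW// divr_gt0.
exists N.+1 => // n /= Nn.
have n0 : (0 < n)%N by exact: leq_ltn_trans Nn.
have n0R : 0 < n%:R :> R by rewrite ltr0n.
have ln : inf S <= n%:R^-1 * u n by rewrite mulrC ler_pdivlMr// mulrC lbS.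
rewrite distrC ger0_norm ?subr_ge0// lerBlDl mulrC ler_pdivrMr//.
have un : u n <= (n %/ m)%:R * u m + C.
  rewrite {1}(divn_eq n m) (le_trans (uM _ _ _))// lerD2l.
  have h := uM 1%N (n %% m)%N 0%N.
  rewrite muln1 addn0 in h; rewrite (le_trans h)// addrC lerD2l.
  by rewrite ler_wpM2r// ler_nat ltnW// ltn_mod.
apply: (le_trans un).
have h1 : (n %/ m)%:R * u m <= n%:R * (inf S + e / 2).
  have qm : (n %/ m)%:R * m%:R <= n%:R :> R by rewrite -natrM ler_nat leq_divM.
  rewrite (le_trans _ (ler_wpM2l (ltW n0R) (ltW ume)))//.
  have -> : (n %/ m)%:R * u m = (n %/ m)%:R * m%:R * (u m / m%:R).
    by rewrite -mulrA (mulrC m%:R) divfK ?pnatr_eq0 -?lt0n.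
  by rewrite ler_wpM2r// divr_ge0.
have h2 : C <= n%:R * (e / 2).
  rewrite -ler_pdivrMr ?divr_gt0// (le_trans (ltW NC))// ler_nat.
  exact: ltnW.
nra.
Qed.

Lemma concave_three_points (R : realType) (F : R -> R) x y z :
  concave_function F -> x < y -> y < z ->
  (z - y) * F x + (y - x) * F z <= (z - x) * F y.
Proof.
move=> cF xy yz; have xz := lt_trans xy yz.
have zx0 : 0 < z - x by rewrite subr_gt0.
have := cF x z ((z - y) / (z - x)).
have -> : 1 - (z - y) / (z - x) = (y - x) / (z - x).
  by field; rewrite gt_eqF.
have -> : (z - y) / (z - x) * x + (y - x) / (z - x) * z = y.
  by field; rewrite gt_eqF.
have t0 : 0 <= (z - y) / (z - x) by rewrite divr_ge0// ltW// subr_gt0.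
have t1 : (z - y) / (z - x) <= 1 by rewrite ler_pdivrMr// mul1r; lra.
move=> /(_ t0 t1); rewrite -(ler_pM2l zx0); apply: le_trans.
rewrite le_eqVlt; apply/orP; left; apply/eqP; field; rewrite gt_eqF//.
Qed.

(** On [-p, p] concavity bounds F below by its values at the endpoints; the
    upper bound follows by reflecting in the midpoint, F x <= 2 F 0 - F (-x).
    *)
Lemma concave_bounded (R : realType) (F : R -> R) p :
  concave_function F -> 0 < p ->
  exists B, forall x, - p <= x <= p -> `|F x| <= B.
Proof.
move=> cF p0.
have lb x : - p <= x <= p -> - (`|F p| + `|F (- p)|) <= F x.
  move=> /andP[xl xr].
  have := cF p (- p) ((x + p) / (p + p)).
  have -> : (x + p) / (p + p) * p + (1 - (x + p) / (p + p)) * - p = x.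
    by field; rewrite gt_eqF// addr_gt0.
  have t0 : 0 <= (x + p) / (p + p) by rewrite divr_ge0//; lra.
  have t1 : (x + p) / (p + p) <= 1 by rewrite ler_pdivrMr ?mul1r; lra.
  move=> /(_ t0 t1); apply: le_trans.
  have := ler_norm (- F p); have := ler_norm (- F (- p)).
  rewrite !normrN; have := normr_ge0 (F p); have := normr_ge0 (F (- p)).
  set t := (_ / _) in t0 t1 *; move=> ? ? ? ?; nra.
exists (`|F p| + `|F (- p)| + 2 * `|F 0|) => x xp; rewrite ler_norml.
have h := lb _ xp; have hN : - p <= - x <= p by case/andP: xp; lra.
have {}hN := lb _ hN.
have := cF x (- x) 2^-1 ltac:(lra) ltac:(lra).
have -> : 2^-1 * x + (1 - 2^-1) * - x = 0 by field.
have := ler_norm (F 0); have := normr_ge0 (F 0).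
by move=> ? ? ?; apply/andP; split; lra.
Qed.

(** Slopes inside [-M, M] are compared with the slopes of chords reaching out
    to the points M + 1 and - (M + 1), at distance at least 1. *)
Lemma concave_lipschitz (R : realType) (F : R -> R) (M : R) :
  concave_function F -> 0 < M ->
  exists2 L, 0 <= L & forall x y, `|x| <= M -> `|y| <= M ->
    `|F x - F y| <= L * `|x - y|.
Proof.
move=> cF M0; have [B FB] := @concave_bounded _ F (M + 1) cF ltac:(lra).
have B0 : 0 <= B.
  by apply: le_trans (FB 0 _); rewrite ?normr_ge0//; apply/andP; split; lra.
exists (2 * B) => [|x y]; first lra.
wlog xy : x y / x < y => [hw xM yM|].
  have [xy|yx|->] := ltgtP x y; first exact: hw.
    by rewrite distrC (distrC x); exact: hw.
  by rewrite !subrr normr0 mulr0.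
rewrite !ler_norml => /andP[xl xr] /andP[yl yr].
have h1 := @concave_three_points _ F x y (M + 1) cF xy ltac:(lra).
have h2 := @concave_three_points _ F (- (M + 1)) x y cF ltac:(lra) xy.
have := FB x ltac:(apply/andP; split; lra).
have := FB y ltac:(apply/andP; split; lra).
have := FB (M + 1) ltac:(apply/andP; split; lra).
have := FB (- (M + 1)) ltac:(apply/andP; split; lra).
rewrite !ler_norml => /andP[a1 a2] /andP[b1 b2] /andP[c1 c2] /andP[d1 d2].
rewrite (distrC x) (ger0_norm (_ : 0 <= y - x)); last lra.
set D := y - x in h1 h2 *.
have D0 : 0 < D by rewrite /D; lra.
have key (a v w : R) : 1 <= a -> w <= 2 * B -> a * v <= D * w -> v <= 2 * B * D.
  move=> a1' w2 avw; rewrite leNgt; apply/negP => h.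
  have v0 : 0 < v by rewrite (le_lt_trans _ h)// !mulr_ge0// ltW.
  have : v <= D * (2 * B).
    apply: le_trans (ler_wpM2l (ltW D0) w2); apply: le_trans avw.
    by rewrite ler_peMl// ltW.
  by rewrite mulrC leNgt h.
apply/andP; split; last first.
  apply: (key (M + 1 - y) _ (F y - F (M + 1))); [lra|lra|rewrite /D in h1 *; lra].
rewrite lerNl opprB; apply: (key (x + (M + 1)) _ (F x - F (- (M + 1)))).
- lra.
- lra.
- rewrite /D in h2 *; lra.
Qed.

(** Separation in the plane of E, convex once closed downwards, from the strict
    epigraph of V - F. As F is finite everywhere, the separating line is not
    vertical. The slope s is the supremum of the difference quotients to the
    right of the points of E. Each of them lies below each quotient to the
    left: two such quotients are compared at the point where the segment
    between the abscissas in E meets the segment between y and y'. *)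
Lemma concave_sandwich (R : realType) (F : R -> R) (V : R) (E : set (R * R)) :
  concave_function F -> E !=set0 ->
  (forall x1 l1 x2 l2 t, E (x1, l1) -> E (x2, l2) -> 0 <= t -> t <= 1 ->
    exists2 l, E (t * x1 + (1 - t) * x2, l) & t * l1 + (1 - t) * l2 <= l) ->
  (forall x l, E (x, l) -> F x + l <= V) ->
  exists s, forall x l y, E (x, l) -> F y + l <= V + s * (y - x).
Proof.
move=> cF [[x0 l0] E0] convE EV.
have slopes x l y x' l' y' : E (x, l) -> E (x', l') -> x < y -> y' < x' ->
    (F y + l - V) / (y - x) <= (V - F y' - l') / (x' - y').
  move=> Exl Exl' xy yx'.
  have a0 : 0 < y - x by rewrite subr_gt0.
  have b0 : 0 < x' - y' by rewrite subr_gt0.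
  set a := y - x in a0 *; set b := x' - y' in b0 *.
  have ab0 : 0 < b + a by rewrite addr_gt0.
  have t0 : 0 <= b / (b + a) by rewrite divr_ge0// ltW.
  have t1 : b / (b + a) <= 1 by rewrite ler_pdivrMr// mul1r lerDl ltW.
  have [lz Ez lzE] := convE _ _ _ _ _ Exl Exl' t0 t1.
  have := cF y y' _ t0 t1.
  have -> : b / (b + a) * y + (1 - b / (b + a)) * y' =
      b / (b + a) * x + (1 - b / (b + a)) * x'.
    have yE : y = x + a by rewrite addrC subrK.
    have yE' : y' = x' - b by rewrite opprB addrC subrK.
    rewrite [in LHS]yE [in LHS]yE'; field; exact: lt0r_neq0.
  have := EV _ _ Ez; move: lzE; set Fz := F (_ + _).
  set t := b / (b + a) => h1 h2 h3.
  have : t * (F y + l - V) + (1 - t) * (F y' + l' - V) <= 0 by lra.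
  rewrite -(pmulr_rle0 _ ab0).
  have -> : (b + a) * (t * (F y + l - V) + (1 - t) * (F y' + l' - V)) =
      b * (F y + l - V) + a * (F y' + l' - V).
    by rewrite /t; field; rewrite gt_eqF.
  by move=> h; rewrite ler_pdivrMr// mulrAC ler_pdivlMr//; lra.
pose S := [set v | exists x l y, [/\ E (x, l), x < y & v = (F y + l - V) / (y - x)]].
have S0 : S !=set0.
  by exists ((F (x0 + 1) + l0 - V) / (x0 + 1 - x0)), x0, l0, (x0 + 1); split; rewrite ?ltrDl.
have Sub x' l' y' : E (x', l') -> y' < x' -> ubound S ((V - F y' - l') / (x' - y')).
  by move=> Exl' yx' _ [x [l [y [Exl xy ->]]]]; exact: slopes.
have hS : has_sup S.
  split => //; exists ((V - F (x0 - 1) - l0) / (x0 - (x0 - 1))).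
  by apply: Sub => //; rewrite gtrBl.
exists (sup S) => x l y Exl; have [xy|yx|<-] := ltgtP x y.
- rewrite addrC -lerBlDl -ler_pdivrMr ?subr_gt0//.
  have -> : l + F y - V = F y + l - V by ring.
  by apply: ub_le_sup; [exact: hS.2|exists x, l, y].
- have : sup S <= (V - F y - l) / (x - y) by apply: ge_sup => //; exact: Sub.
  rewrite ler_pdivlMr ?subr_gt0//; lra.
- by rewrite subrr mulr0 addr0; exact: EV.
Qed.

(** The sandwich lemma applied to a single point gives a supporting line of F
    at the barycentre. *)
Lemma concave_jensen (R : realType) (F : R -> R) (I : finType) (p a : I -> R) :
  concave_function F -> (forall i, 0 <= p i) -> \sum_i p i = 1 ->
  \sum_i p i * F (a i) <= F (\sum_i p i * a i).
Proof.
move=> cF p0 p1; set z := \sum_i p i * a i.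
have [||_ l [-> ->]|s sP] := @concave_sandwich _ F (F z) [set (z, 0)] cF.
- by exists (z, 0).
- move=> x1 l1 x2 l2 t [-> ->] [-> ->] t0 t1; exists 0; last by rewrite !mulr0 addr0.
  by congr (_, _); ring.
- by rewrite addr0.
apply: (@le_trans _ _ (\sum_i p i * (F z + s * (a i - z)))).
  by apply: ler_sum => i _; rewrite ler_wpM2l//; have := sP z 0 (a i) erefl; rewrite addr0.
under eq_bigr do rewrite mulrDr mulrCA mulrBr.
rewrite big_split/= -mulr_suml p1 mul1r -mulr_sumr sumrB -mulr_suml p1 mul1r.
by rewrite subrr mulr0 addr0.
Qed.

(** * Approximation of Borel partitions by cylinders *)

Section probability_real.
Context {disp : measure_display} {X : measurableType disp} {R : realType}.
Variable P : probability X R.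

Definition pr (B : set X) : R := fine (P B).

Lemma pr_ge0 B : 0 <= pr B.
Proof. by rewrite fine_ge0. Qed.

Lemma EFin_pr B : measurable B -> (pr B)%:E = P B.
Proof. by move=> mB; rewrite fineK// fin_num_probability. Qed.

Lemma pr_le B C : measurable B -> measurable C -> B `<=` C -> pr B <= pr C.
Proof.
move=> mB mC BC; rewrite -lee_fin !EFin_pr//.
by apply: le_measure; rewrite ?inE.
Qed.

Lemma pr_setU B C : measurable B -> measurable C ->
  pr (B `|` C) <= pr B + pr C.
Proof.
move=> mB mC; rewrite -lee_fin EFinD !EFin_pr//; last exact: measurableU.
exact: measureU2.
Qed.

Lemma pr_bigsetU (I : Type) (s : seq I) (E : I -> set X) :
  (forall i, measurable (E i)) ->
  pr (\big[setU/set0]_(i <- s) E i) <= \sum_(i <- s) pr (E i).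
Proof.
move=> mE; elim: s => [|i s IH].
  by rewrite !big_nil /pr measure0.
rewrite !big_cons; apply: le_trans (pr_setU _ _) _ => //.
  by apply: bigsetU_measurable.
by rewrite lerD2l.
Qed.

Lemma pr_setD_bigcup (F : nat -> set X) (e : R) :
  (forall i, measurable (F i)) -> nondecreasing_seq F -> 0 < e ->
  exists n, pr (\bigcup_i F i `\` F n) < e.
Proof.
move=> mF ndF e0.
have mU : measurable (\bigcup_i F i) by exact: bigcupT_measurable.
have : pr (F n) @[n --> \oo] --> pr (\bigcup_i F i).
  have h := nondecreasing_cvg_mu mF mU ndF (mu := P).
  by apply: fine_cvg; rewrite EFin_pr.
move=> /cvgrPdist_lt /(_ e e0)[n _ /(_ n (leqnn n)) /= h].
exists n; apply: le_lt_trans h; apply: le_trans (ler_norm _).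
have -> : pr (\bigcup_i F i `\` F n) = pr (\bigcup_i F i) - pr (F n) => //.
have Fn : F n = \bigcup_i F i `&` F n.
  by rewrite setIidr// => x Fx; exists n.
apply: EFin_inj; rewrite EFinB !EFin_pr//; last exact: measurableD.
rewrite [in RHS]Fn measureD//.
exact: (le_lt_trans (probability_le1 P mU) (ltry _)).
Qed.

End probability_real.

Section cylinder_approximation.
Context {R : realType} {d : nat}.
Local Notation Om := (borel_shift R d).
Local Notation fvm := (@finite_valued_measurable _ _ _).
Variable rho : probability Om R.

(** The error is recorded as an exceptional set outside of which B and the
    cylinder agree; intersections and differences then only require the union
    of the exceptional sets. *)
Definition approximable (B : set Om) : Prop :=
  measurable B /\ forall e, 0 < e ->
    exists (n : nat) (S : set {ffun 'I_n -> 'I_d.+1}) (E : set Om),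
      [/\ measurable E, pr rho E <= e &
          forall x, ~ E x -> (B x <-> S (word n x))].

Lemma approximable_lambda : lambda_system setT approximable.
Proof.
split => [//| |A B BA [mA aA] [mB aB]|F ndF aF].
- split => // e e0; exists 0%N, setT, set0; split => //.
  by rewrite /pr measure0 ltW.
- split; first exact: measurableD.
  move=> e e0; have e20 : 0 < e / 2 by lra.
  have [n [S [E [mE Ee SE]]]] := aA _ e20.
  have [m [S' [E' [mE' Ee' SE']]]] := aB _ e20.
  pose lift k (S0 : set {ffun 'I_k -> 'I_d.+1}) :
    set {ffun 'I_(maxn n m) -> 'I_d.+1} :=
    [set w | forall y : Om, word (maxn n m) y = w -> S0 (word k y)].
  have liftE k (S0 : set {ffun 'I_k -> 'I_d.+1}) (x : Om) : (k <= maxn n m)%N ->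
      lift k S0 (word (maxn n m) x) <-> S0 (word k x).
    by move=> km; split => [|Sx y /(word_eq_le km) ->//]; exact.
  exists (maxn n m), (lift n S `\` lift m S'), (E `|` E').
  split; first exact: measurableU.
    by rewrite (le_trans (pr_setU _ mE mE'))//; lra.
  move=> x /not_orP[Ex E'x] /=.
  by rewrite (liftE _ _ _ (leq_maxl n m)) (liftE _ _ _ (leq_maxr n m)) SE// SE'.
- have mF i : measurable (F i) by have [] := aF i.
  split; first exact: bigcupT_measurable.
  move=> e e0; have e20 : 0 < e / 2 by lra.
  have [k Fk] := pr_setD_bigcup rho mF ndF e20.
  have [_ /(_ _ e20)[n [S [E [mE Ee SE]]]]] := aF k.
  have mD : measurable (\bigcup_i F i `\` F k).
    by apply: measurableD => //; exact: bigcupT_measurable.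
  exists n, S, (E `|` (\bigcup_i F i `\` F k)).
  split; first exact: measurableU.
    by rewrite (le_trans (pr_setU _ mE mD))//; move: Fk; lra.
  move=> x /not_orP[Ex /= nFx]; rewrite -SE//; split; last by exists k.
  by move=> Ux; apply: contrapT => nFk; apply: nFx.
Qed.

(** Approximable sets form a lambda-system that contains the pi-system of
    cylinders. *)
Lemma measurable_approximable (B : set Om) : measurable B -> approximable B.
Proof.
rewrite measurable_cylinders => mB.
apply: (@lambda_system_subset _ cylinders _ setT) mB => //.
- exact: setI_closed_cylinders.
- exact: approximable_lambda.
- move=> _ [n [S ->]]; split.
    by apply: fvm_preimage; exact: fvm_word.
  move=> e e0; exists n, S, set0; split => //.
  by rewrite /pr measure0 ltW.
Qed.

(** Each fibre of Y is approximated by a cylinder, all over a common number of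
    letters; f w is then any index whose cylinder contains w. It can be wrong
    only on the union of the exceptional sets. *)
Lemma fvm_word_approximation (I : finType) (Y : Om -> I) (e : R) :
  fvm Y -> 0 < e ->
  exists (m : nat) (f : {ffun 'I_m -> 'I_d.+1} -> I),
    pr rho [set x | Y x <> f (word m x)] <= e.
Proof.
move=> mY e0; pose i0 := Y point.
have I0 : (0 < #|I|)%N by apply/card_gt0P; exists i0.
have e'0 : 0 < e / #|I|%:R by rewrite divr_gt0// ltr0n.
have aY i := (measurable_approximable (mY i)).2 _ e'0.
pose n i := projT1 (cid (aY i)); pose aY' i := projT2 (cid (aY i)).
pose S i := projT1 (cid (aY' i)); pose aY'' i := projT2 (cid (aY' i)).
pose E i := projT1 (cid (aY'' i)).
have [mE Ee SE] : [/\ forall i, measurable (E i), forall i, pr rho (E i) <= e / #|I|%:R &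
   forall i x, ~ E i x -> (Y x = i <-> S i (word (n i) x))].
  by split => i; have [] := projT2 (cid (aY'' i)).
pose m := (\max_i n i)%N.
have nm i : (n i <= m)%N by rewrite /m leq_bigmax.
pose S' i : set {ffun 'I_m -> 'I_d.+1} :=
  [set w | forall y : Om, word m y = w -> S i (word (n i) y)].
have S'E i (x : Om) : S' i (word m x) <-> S i (word (n i) x).
  by split => [|Sx y /(word_eq_le (nm i)) ->//]; exact.
exists m, (fun w => odflt i0 [pick i | w \in S' i]).
have mU : measurable (\big[setU/set0]_i E i) by exact: bigsetU_measurable.
apply: (@le_trans _ _ (pr rho (\big[setU/set0]_i E i))).
  apply: pr_le => //.
    apply: (@fvm_preimage _ _ _ (fun x => (Y x, word m x))
      [set z | z.1 <> odflt i0 [pick i | z.2 \in S' i]]).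
    by apply: fvm_pair => //; exact: fvm_word.
  move=> x /= Yx; apply: contrapT => nE; apply: Yx.
  have {}nE i : ~ E i x.
    by move=> Ei; apply: nE; rewrite -bigcup_seq; exists i => //=; rewrite mem_index_enum.
  case: pickP => [j|/(_ (Y x))/=]; first by rewrite inE S'E => /SE; apply.
  by move=> /negP []; rewrite inE S'E -SE.
apply: (le_trans (pr_bigsetU _ _ mE)).
apply: (@le_trans _ _ (\sum_(i : I) e / #|I|%:R)); first exact: ler_sum.
by rewrite sumr_const -(mulr_natr (e / _)) divfK// pnatr_eq0 -lt0n.
Qed.

End cylinder_approximation.

(** * Itineraries and the Kolmogorov-Sinai inequality *)

Lemma le_mul_large (R : realType) (C e : R) : 0 < e ->
  exists N, forall n, (N <= n)%N -> C <= n%:R * e.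
Proof.
move=> e0; exists (Num.bound (`|C| / e)) => n Nn.
rewrite -ler_pdivrMr//; apply: (@le_trans _ _ (`|C| / e)).
  by rewrite ler_pM2r ?invr_gt0// ler_norm.
apply: (le_trans (ltW (archi_boundP _))); last by rewrite ler_nat.
by rewrite divr_ge0// ltW.
Qed.

Lemma ln_prod (R : realType) (I : finType) (c : I -> R) :
  (forall i, 0 < c i) -> ln (\prod_i c i) = \sum_i ln (c i).
Proof.
move=> c0.
suff [_ //] : 0 < \prod_i c i /\ ln (\prod_i c i) = \sum_i ln (c i).
apply: (big_ind2 (fun x y => 0 < x /\ ln x = y)).
- by rewrite ltr01 ln1.
- move=> x1 x2 y1 y2 [x0 <-] [y0 <-]; split; first exact: mulr_gt0.
  by rewrite lnM ?posrE.
- by [].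
Qed.

Section entropy_of_pairs.
Context {disp : measure_display} {X : measurableType disp} {R : realType}.
Variable P : probability X R.
Local Notation fvm := (@finite_valued_measurable _ X _).

(** [gibbs] against the product of the marginals. *)
Lemma entropy_law_pair (I J : finType) (Y : X -> I) (Z : X -> J) :
  fvm Y -> fvm Z ->
  entropy (law P (fun x => (Y x, Z x))) <=
  entropy (law P Y) + entropy (law P Z).
Proof.
move=> mY mZ; have mYZ := fvm_pair mY mZ.
set W := (fun x => (Y x, Z x)) in mYZ *.
pose q (z : I * J) := law P Y z.1 * law P Z z.2.
have lY z : law P W z <= law P Y z.1 := law_le_comp P fst z mYZ.
have lZ z : law P W z <= law P Z z.2 := law_le_comp P snd z mYZ.
apply: (@le_trans _ _ (- \sum_z law P W z * ln (q z))).
  apply: entropy_le_cross.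
  - by move=> z; exact: law_ge0.
  - by move=> z; rewrite mulr_ge0 ?law_ge0.
  - by move=> z z0; rewrite mulr_gt0// (lt_le_trans z0).
  - rewrite sum_law// -(pair_bigA _ (fun i j => law P Y i * law P Z j))/=.
    under eq_bigr do rewrite -mulr_sumr sum_law// mulr1.
    by rewrite sum_law.
rewrite (eq_bigr (fun z => law P W z * ln (law P Y z.1) +
                           law P W z * ln (law P Z z.2))); last first.
  move=> z _; have := law_ge0 P W z; rewrite le_eqVlt => /predU1P[<-|z0].
    by rewrite !mul0r addr0.
  by rewrite -mulrDr lnM// posrE (lt_le_trans z0).
rewrite big_split/= opprD; apply: lerD.
  by rewrite -(law_map P fst (fun i => ln (law P Y i)) mYZ).
by rewrite -(law_map P snd (fun j => ln (law P Z j)) mYZ).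
Qed.

End entropy_of_pairs.

Section kolmogorov_sinai.
Context {R : realType} {d : nat}.
Local Notation Om := (borel_shift R d).
Local Notation T := (@shift_map R d : Om -> Om).
Local Notation fvm := (@finite_valued_measurable _ Om _).
Variable rho : probability Om R.
Hypothesis rho_inv : invariant_probability T rho.

Definition itinerary (I : finType) (Y : Om -> I) (n : nat) (x : Om) :
  {ffun 'I_n -> I} := [ffun i : 'I_n => Y (iter i T x)].

Lemma fvm_itinerary (I : finType) (Y : Om -> I) n : fvm Y -> fvm (itinerary Y n).
Proof. by move=> mY; apply: fvm_ffun => i; exact: (@fvm_iter_shift R d I Y). Qed.

Lemma itinerary_letter n : itinerary (fun x : Om => x 0%N) n = @word R d n.
Proof.
by apply/funext => x; apply/ffunP => i; rewrite !ffunE iter_shift addn0.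
Qed.

(** An itinerary of length m + n is an itinerary of length m together with one
    of length n seen from time m, whose law is the same by invariance. *)
Lemma itinerary_entropy_subadditive (I : finType) (Y : Om -> I) m n : fvm Y ->
  entropy (law rho (itinerary Y (m + n))) <=
  entropy (law rho (itinerary Y m)) + entropy (law rho (itinerary Y n)).
Proof.
move=> mY.
pose g (z : {ffun 'I_m -> I} * {ffun 'I_n -> I}) : {ffun 'I_(m + n) -> I} :=
  [ffun i : 'I_(m + n) => match fintype.split i with inl j => z.1 j | inr j => z.2 j end].
have -> : itinerary Y (m + n) =
    g \o (fun x => (itinerary Y m x, (itinerary Y n \o iter m T) x)).
  apply/funext => x; apply/ffunP => i; rewrite !ffunE /=.
  case: splitP => j ij; rewrite !ffunE ij//.
  by rewrite addnC iterD.
have mn := fvm_itinerary (n := n) mY; have mm := fvm_itinerary (n := m) mY.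
apply: (le_trans (entropy_law_comp _ _ _)).
  by apply: fvm_pair => //; exact: fvm_iter_shift.
apply: (le_trans (entropy_law_pair _ _ _)) => //; first exact: fvm_iter_shift.
by rewrite law_iter_shift.
Qed.

Lemma itinerary_entropy_rate (I : finType) (Y : Om -> I) : fvm Y ->
  exists2 l : R,
    n%:R^-1 * entropy (law rho (itinerary Y n)) @[n --> \oo] --> l &
    forall n, (0 < n)%N -> n%:R * l <= entropy (law rho (itinerary Y n)).
Proof.
move=> mY; apply: fekete => [n|m n].
  by apply: entropy_law_ge0; exact: fvm_itinerary.
exact: itinerary_entropy_subadditive.
Qed.

(** The probability of emitting a when b is sent: b is transmitted with
    probability 1 - e and replaced by a uniform symbol otherwise. The uniform
    part keeps the logarithm finite at the rare errors. *)
Definition noisy_channel (I : finType) (e : R) (a b : I) : R :=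
  (1 - e) * (a == b)%:R + e / #|I|%:R.

Lemma noisy_channel_gt0 (I : finType) (e : R) (a b : I) :
  0 < e -> e < 1 -> 0 < noisy_channel e a b.
Proof.
move=> e0 e1; rewrite ltr_wpDl// ?mulr_ge0//; first lra.
by rewrite divr_gt0// ltr0n; apply/card_gt0P; exists a.
Qed.

Lemma sum_noisy_channel (I : finType) (e : R) (b : I) :
  \sum_a noisy_channel e a b = 1.
Proof.
rewrite big_split/= -mulr_sumr (bigD1 b)//= eqxx big1 ?addr0; last first.
  by move=> a /negbTE ->.
rewrite sumr_const -(mulr_natr (e / _)) divfK ?mulr1 ?subrK// pnatr_eq0 -lt0n.
by apply/card_gt0P; exists b.
Qed.

Lemma ln_noisy_channel (I : finType) (e : R) (a b : I) : 0 < e -> e < 1 ->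
  - ln (noisy_channel e a b) <= - ln (1 - e) + (a != b)%:R * ln (#|I|%:R / e).
Proof.
move=> e0 e1; rewrite /noisy_channel.
have I0 : 0 < #|I|%:R :> R by rewrite ltr0n; apply/card_gt0P; exists a.
have [ab|ab] := eqVneq a b; rewrite ?mulr1 ?mulr0 ?mul0r ?mul1r ?addr0 ?add0r.
  rewrite lerN2 ler_ln ?posrE; [|lra|].
    by rewrite lerDl ltW// divr_gt0.
  by rewrite addr_gt0 ?divr_gt0//; lra.
rewrite -lnV ?posrE ?divr_gt0// invf_div lerDr oppr_ge0.
by apply: ln_le0; lra.
Qed.

(** [gibbs] for the joint law of the itinerary a and of the word w, against the
    model in which w has its true law and each a_i is the output of the noisy
    channel fed with the guess f made from the window of w at time i. The model
    charges the itinerary the cost of the word plus, for each symbol, the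
    expected cost of the channel, which does not depend on the time by
    invariance. *)
Lemma itinerary_entropy_le_word (I : finType) (Y : Om -> I) (m : nat)
    (f : {ffun 'I_m -> 'I_d.+1} -> I) (e : R) n : fvm Y -> 0 < e -> e < 1 ->
  entropy (law rho (itinerary Y n)) <=
  entropy (law rho (@word R d (n + m))) + n%:R * (- ln (1 - e) +
    pr rho [set x | Y x <> f (word m x)] * ln (#|I|%:R / e)).
Proof.
move=> mY e0 e1.
pose Z (x : Om) := (itinerary Y n x, word (n + m) x).
have mZ : fvm Z by apply: fvm_pair; [exact: fvm_itinerary|exact: fvm_word].
pose window (i : 'I_n) (w : {ffun 'I_(n + m) -> 'I_d.+1}) :
    {ffun 'I_m -> 'I_d.+1} := [ffun j : 'I_m =>
  w (Ordinal (leq_add (ltn_ord i) (ltnW (ltn_ord j)) : (i + j < n + m)%N))].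
have windowE i x : window i (word (n + m) x) = word m (iter i T x).
  by apply/ffunP => j; rewrite !ffunE/= iter_shift.
pose J (x : Om) := (Y x, f (word m x)).
have mfW : fvm (f \o @word R d m) by apply: fvm_comp; exact: fvm_word.
have mJ : fvm J by exact: fvm_pair.
pose q (z : {ffun 'I_n -> I} * {ffun 'I_(n + m) -> 'I_d.+1}) : R :=
  law rho (@word R d (n + m)) z.2 *
  \prod_i noisy_channel e (z.1 i) (f (window i z.2)).
have prod0 (z : {ffun 'I_n -> I} * {ffun 'I_(n + m) -> 'I_d.+1}) :
    0 < \prod_i noisy_channel e (z.1 i) (f (window i z.2)).
  by apply: prodr_gt0 => i _; exact: noisy_channel_gt0.
have lW z : law rho Z z <= law rho (@word R d (n + m)) z.2 :=
  law_le_comp rho snd z mZ.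
have mW := @fvm_word R d (n + m).
apply: (@le_trans _ _ (entropy (law rho Z))).
  exact: (entropy_law_comp rho fst mZ).
apply: (@le_trans _ _ (- \sum_z law rho Z z * ln (q z))).
  apply: entropy_le_cross.
  - by move=> z; exact: law_ge0.
  - by move=> z; rewrite mulr_ge0 ?law_ge0// ltW.
  - by move=> z z0; rewrite mulr_gt0// (lt_le_trans z0).
  - rewrite sum_law// -(pair_bigA _ (fun (a : {ffun 'I_n -> I}) w =>
      law rho (@word R d (n + m)) w *
      \prod_i noisy_channel e (a i) (f (window i w))))/=.
    rewrite exchange_big/=.
    rewrite (eq_bigr (law rho (@word R d (n + m)))) ?sum_law// => w _.
    rewrite -mulr_sumr -(bigA_distr_bigA (fun (i : 'I_n) (a : I) =>
      noisy_channel e a (f (window i w)))).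
    by rewrite big1 ?mulr1// => i _; exact: sum_noisy_channel.
rewrite (eq_bigr (fun z => law rho Z z * ln (law rho (@word R d (n + m)) z.2) -
    \sum_i law rho Z z * - ln (noisy_channel e (z.1 i) (f (window i z.2))))); last first.
  move=> z _; have := law_ge0 rho Z z; rewrite le_eqVlt => /predU1P[<-|z0].
    by rewrite !mul0r big1 ?subr0// => i _; rewrite mul0r.
  rewrite -mulr_sumr -mulrBr sumrN opprK /q lnM ?posrE ?prod0//; last first.
    exact: lt_le_trans (lW z).
  by rewrite ln_prod// => i; exact: noisy_channel_gt0.
rewrite sumrB opprB addrC; apply: lerD.
  by rewrite -(law_map rho snd (fun w => ln (law rho (@word R d (n + m)) w)) mZ).
rewrite exchange_big/=.
rewrite (eq_bigr (fun=> \sum_z law rho J z * - ln (noisy_channel e z.1 z.2))); last first.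
  move=> i _; rewrite -(law_iter_shift i rho_inv mJ).
  rewrite -(law_map rho (fun z : {ffun 'I_n -> I} * {ffun 'I_(n + m) -> 'I_d.+1} =>
      (z.1 i, f (window i z.2)))
    (fun z => - ln (noisy_channel e z.1 z.2)) mZ).
  congr (\sum_z law rho _ z * _); apply/funext => z.
  by apply/funext => x; rewrite /Z /J /= windowE ffunE.
rewrite sumr_const card_ord -[X in X <= _]mulr_natl ler_wpM2l//.
apply: (@le_trans _ _ (\sum_z law rho J z * (- ln (1 - e) +
    (z.1 != z.2)%:R * ln (#|I|%:R / e)))).
  by apply: ler_sum => z _; rewrite ler_wpM2l ?law_ge0// ln_noisy_channel.
under eq_bigr do rewrite mulrDr.
rewrite big_split/= -mulr_suml sum_law// mul1r lerD2l.
under eq_bigr do rewrite mulrA.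
rewrite -mulr_suml.
have -> : \sum_z law rho J z * (z.1 != z.2)%:R =
    pr rho [set x | Y x <> f (word m x)].
  have := law_comp rho (fun z : I * I => z.1 != z.2) true mJ.
  rewrite /law /pr.
  have -> : ((fun z : I * I => z.1 != z.2) \o J) @^-1` [set true] =
     [set x | Y x <> f (word m x)].
    by apply/seteqP; split => x /= => [/eqP|/eqP].
  move=> ->; rewrite [RHS]big_mkcond/=; apply: eq_bigr => z _.
  by rewrite eqb_id; case: (z.1 != z.2); rewrite (mulr1, mulr0).
by [].
Qed.

(** The Kolmogorov-Sinai theorem for the partition into first letters. The
    noise c is chosen first, so that a correct guess costs e / 4; then the
    guess is made so accurate that the errors cost at most e / 4 on average. *)
Lemma itinerary_entropy_rate_le (I : finType) (Y : Om -> I) (l lY : R) : fvm Y ->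
  n%:R^-1 * entropy (law rho (@word R d n)) @[n --> \oo] --> l ->
  (forall n, (0 < n)%N -> n%:R * lY <= entropy (law rho (itinerary Y n))) ->
  lY <= l.
Proof.
move=> mY cl lbY; apply/ler_addgt0Pr => e e0.
pose c := 1 - expR (- (e / 4)).
have c0 : 0 < c by rewrite subr_gt0 expR_lt1; lra.
have c1 : c < 1 by have := expR_gt0 (- (e / 4)); rewrite /c; lra.
have lnc : - ln (1 - c) = e / 4 by rewrite /c opprB addrCA subrr addr0 expRK opprK.
have I0 : (0 < #|I|)%N by apply/card_gt0P; exists (Y point).
have K0 : 0 <= ln (#|I|%:R / c).
  apply: ln_ge0; rewrite ler_pdivlMr// mul1r (le_trans (ltW c1))//.
  by rewrite ler1n.
set K := ln _ in K0.
have e'0 : 0 < e / 4 / (1 + K) by rewrite !divr_gt0//; lra.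
have [m [f fY]] := fvm_word_approximation rho mY e'0.
have bad : pr rho [set x | Y x <> f (word m x)] * K <= e / 4.
  apply: (@le_trans _ _ (e / 4 / (1 + K) * (1 + K))).
    by apply: ler_pM => //; [exact: pr_ge0|lra].
  by rewrite divfK// gt_eqF//; lra.
have [N Nl] : exists N, forall n, (N <= n)%N ->
    n%:R^-1 * entropy (law rho (@word R d n)) <= l + e / 4.
  move/cvgrPdist_le : cl => /(_ (e / 4) ltac:(lra))[N _ h].
  by exists N => n /h /=; rewrite ler_norml => /andP[+ _]; lra.
have [N' N'm] := @le_mul_large _ (entropy (law rho (@word R d m))) (e / 4) ltac:(lra).
pose n := (maxn N N').+1.
have n0 : 0 < n%:R :> R by rewrite ltr0n.
have h1 := lbY n isT.
have h2 := @itinerary_entropy_le_word I Y m f c n mY c0 c1.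
have h3 := @itinerary_entropy_subadditive _ (fun x : Om => x 0%N) n m (@fvm_coord R d 0).
rewrite !itinerary_letter in h3.
have h4 := N'm n (leqW (leq_maxr _ _)).
have h5 := Nl n (leqW (leq_maxl _ _)).
rewrite mulrC ler_pdivrMr// in h5.
rewrite -(ler_pM2l n0).
have : n%:R * (- ln (1 - c) + pr rho [set x | Y x <> f (word m x)] * K) <=
   n%:R * (e / 4 + e / 4) by rewrite ler_pM2l// lnc lerD2l.
move: h1 h2 h3 h4 h5; rewrite -/K.
set a1 := _ * lY; set a2 := n%:R * (- _ + _).
rewrite !mulrDr [(l + _) * _]mulrDl (mulrC l) (mulrC (e / 4)).
move=> *; lra.
Qed.

End kolmogorov_sinai.

(** * The entropy of the shift as an entropy rate of words *)

Section ks_entropy_of_shift.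
Context {R : realType} {d : nat}.
Local Notation Om := (borel_shift R d).
Local Notation T := (@shift_map R d : Om -> Om).
Local Notation fvm := (@finite_valued_measurable _ Om _).
Variable rho : probability Om R.
Hypothesis rho_inv : invariant_probability T rho.

Lemma join_entropyE (k : nat) (P : 'I_k -> set Om) (Y : Om -> 'I_k) n :
  (forall i, Y @^-1` [set i] = P i) ->
  join_entropy T rho P n = entropy (law rho (itinerary Y n)).
Proof.
move=> YP; rewrite /join_entropy /entropy; congr (- _).
apply: eq_bigr => w _; rewrite /law.
have -> : join_cell T P w = itinerary Y n @^-1` [set w]; last by [].
apply/seteqP; split => x /=.
  move=> h; apply/ffunP => i; rewrite ffunE.
  by have := h i I; rewrite -YP.
by move=> <- i _; rewrite -YP /= ffunE.
Qed.

Lemma partition_index (k : nat) (P : 'I_k -> set Om) :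
  partition [set: 'I_k] P [set: Om] ->
  exists Y : Om -> 'I_k, forall i, Y @^-1` [set i] = P i.
Proof.
move=> [covP trivP _].
have PY x : exists i, P i x.
  by have : [set: Om] x by []; rewrite -covP => -[i _ Pix]; exists i.
exists (fun x => projT1 (cid (PY x))) => i.
apply/seteqP; split => x /=; first by move=> <-; exact: projT2 (cid (PY x)).
move=> Pix; apply: contrapT => ni.
have /trivIsetP := trivP => /(_ _ _ I I (introN eqP ni)).
move=> /seteqP[/(_ x) + _]; apply; split => //.
exact: projT2 (cid (PY x)).
Qed.

(** The first-letter partition attains the supremum by definition, and no
    partition exceeds it by [itinerary_entropy_rate_le]. *)
Lemma ks_entropyE (l : R) :
  n%:R^-1 * entropy (law rho (@word R d n)) @[n --> \oo] --> l ->
  ks_entropy T rho = l%:E.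
Proof.
move=> cl; apply/eqP; rewrite eq_le; apply/andP; split.
  apply: ge_ereal_sup => _ [k [P [mP partP ->]]]; rewrite lee_fin.
  have [Y YP] := partition_index partP.
  have mY : fvm Y by move=> i; rewrite YP.
  have [lY cY lbY] := itinerary_entropy_rate rho_inv mY.
  rewrite /partition_entropy; under eq_fun do rewrite (join_entropyE _ YP).
  rewrite (cvg_lim _ cY)//; exact: (itinerary_entropy_rate_le rho_inv mY cl lbY).
apply: ereal_sup_ubound.
pose P (a : 'I_d.+1) : set Om := (fun x : Om => x 0%N) @^-1` [set a].
exists d.+1, P; split.
- by move=> a; exact: fvm_coord.
- split.
  + by apply/seteqP; split => // x _; exists (x 0%N).
  + apply/trivIsetP => i j _ _ ij; apply/seteqP; split => // x [/= xi xj].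
    by move: ij; rewrite -xi -xj eqxx.
  + by move=> i _; exists (fun=> i).
- rewrite /partition_entropy.
  under eq_fun do rewrite (@join_entropyE _ P (fun x : Om => x 0%N))// itinerary_letter.
  by congr EFin; apply/esym/cvg_lim.
Qed.

Lemma word_entropy_rate : exists l : R,
  [/\ n%:R^-1 * entropy (law rho (@word R d n)) @[n --> \oo] --> l,
      forall n, (0 < n)%N -> n%:R * l <= entropy (law rho (@word R d n)),
      0 <= l, l <= ln d.+1%:R & ks_entropy T rho = l%:E].
Proof.
have [l cl lb] := itinerary_entropy_rate rho_inv (@fvm_coord R d 0).
have cl' : n%:R^-1 * entropy (law rho (@word R d n)) @[n --> \oo] --> l.
  by under eq_fun do rewrite -itinerary_letter.
exists l; split => //.
- by move=> n n0; rewrite -itinerary_letter; exact: lb.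
- rewrite -(cvg_lim _ cl')//; apply: limr_ge; first by apply/cvg_ex; exists l.
  near=> n; rewrite mulr_ge0//; apply: entropy_law_ge0; exact: fvm_word.
- have := lb 1%N isT; rewrite mul1r => /le_trans; apply.
  rewrite itinerary_letter (le_trans (entropy_le_card _ _))//.
  + by move=> w; exact: law_ge0.
  + by apply: sum_law; exact: fvm_word.
  + by rewrite card_ffun !card_ord expn1.
- exact: ks_entropyE.
Unshelve. all: by end_near. Qed.

End ks_entropy_of_shift.

(** * Independent sequences with a prescribed finite law *)

Section unit_interval_probability.
Variable R : realType.

Definition unit_lebesgue : set (measurableTypeR R) -> \bar R :=
  mrestr (@lebesgue_measure R) (measurable_itv `[0%R, 1%R[).

HB.instance Definition _ := Measure.copy unit_lebesgue
  (mrestr (@lebesgue_measure R) (measurable_itv `[0%R, 1%R[)).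

Lemma unit_lebesgue_setT : unit_lebesgue setT = 1%E.
Proof.
by rewrite /unit_lebesgue /mrestr setTI lebesgue_measure_itv/= lte_fin ltr01 oppr0 adde0.
Qed.

HB.instance Definition _ := Measure_isProbability.Build _ _ _
  unit_lebesgue unit_lebesgue_setT.

End unit_interval_probability.

Section interval_coding.
Variables (R : realType) (B : finType) (p : B -> R) (b0 : B).
Hypothesis p0 : forall b, 0 <= p b.
Hypothesis p1 : \sum_b p b = 1.

(** The left endpoint of the subinterval of [0, 1) of length p b reserved for
    the symbol b. *)
Definition cumul (b : B) : R := \sum_(a | (enum_rank a < enum_rank b)%N) p a.

Definition branch (t : R) : B :=
  odflt b0 [pick b | cumul b <= t < cumul b + p b].

(** The piecewise affine map that stretches the interval of each symbol onto
    [0, 1); its itineraries are the coded sequences. *)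
Definition expand (t : R) : R := (t - cumul (branch t)) / p (branch t).

Lemma cumul_ge0 b : 0 <= cumul b.
Proof. exact: sumr_ge0. Qed.

Lemma cumul_le a b : (enum_rank a < enum_rank b)%N -> cumul a + p a <= cumul b.
Proof.
move=> ab; rewrite [leRHS](bigID (fun c => (enum_rank c < enum_rank a)%N))/=.
have -> : \sum_(c | (enum_rank c < enum_rank b)%N && (enum_rank c < enum_rank a)%N)
    p c = cumul a.
  apply: eq_bigl => c.
  by case: (ltnP (enum_rank c) (enum_rank a)) => ca; rewrite ?(ltn_trans ca ab) ?andbF.
by rewrite lerD2l (bigD1 a)/= ?ab ?ltnn// lerDl sumr_ge0.
Qed.

Lemma cumul_le1 b : cumul b + p b <= 1.
Proof.
rewrite -p1 (bigID (fun c => (enum_rank c < enum_rank b)%N))/= lerD2l.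
by rewrite (bigD1 b) ?ltnn//= lerDl sumr_ge0.
Qed.

Lemma cumul_cover t : 0 <= t < 1 -> exists b, cumul b <= t < cumul b + p b.
Proof.
move=> /andP[t0 t1].
have : exists n : nat, (n <= #|B|)%N && (t < \sum_(b | (enum_rank b < n)%N) p b).
  exists #|B|; rewrite leqnn/= (eq_bigl predT) ?p1// => b.
  by rewrite ltn_ord.
move=> /ex_minnP[[|n]]; first by rewrite big1 ?ltNge ?t0 ?andbF//.
move=> /andP[nB tn] minn; pose b := enum_val (Ordinal nB).
have rb : enum_rank b = n :> nat by rewrite enum_valK.
have E : \sum_(c | (enum_rank c < n.+1)%N) p c = cumul b + p b.
  rewrite (bigD1 b)/= ?rb// addrC; congr (_ + _); apply: eq_bigl => c.
  rewrite ltnS [RHS]ltn_neqAle rb andbC; congr (~~ _ && _).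
  by rewrite -(inj_eq enum_rank_inj) -(inj_eq val_inj)/= rb.
exists b; rewrite -E tn andbT leNgt; apply/negP => tb.
have := minn n; rewrite (ltnW nB)/=.
have -> : \sum_(c | (enum_rank c < n)%N) p c = cumul b.
  by apply: eq_bigl => c; rewrite rb.
by rewrite tb => /(_ isT); rewrite ltnn.
Qed.

Lemma branchE t b : cumul b <= t < cumul b + p b -> branch t = b.
Proof.
move=> /andP[bt tb]; rewrite /branch; case: pickP => [a /andP[at_ ta]|/(_ b)]/=.
  case: (ltngtP (enum_rank a) (enum_rank b)) => [/cumul_le h|/cumul_le h|].
  - by have := lt_le_trans ta (le_trans h bt); rewrite ltxx.
  - by have := lt_le_trans tb (le_trans h at_); rewrite ltxx.
  - by move/ord_inj/enum_rank_inj.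
by rewrite bt tb.
Qed.

Lemma branchP t : 0 <= t < 1 ->
  cumul (branch t) <= t < cumul (branch t) + p (branch t).
Proof. by move=> /cumul_cover[b h]; rewrite (branchE h). Qed.

Lemma expand_itv t : 0 <= t < 1 -> 0 <= expand t < 1.
Proof.
move=> /branchP /andP[h1 h2]; have pb : 0 < p (branch t) by lra.
rewrite /expand divr_ge0 ?subr_ge0//= ltr_pdivrMr// mul1r; lra.
Qed.

(** The left endpoint of the interval of the points whose coded sequence starts
    with s; its length is [code_width]. *)
Fixpoint code_left (s : seq B) : R :=
  if s is b :: s' then cumul b + p b * code_left s' else 0.

Definition code_width (s : seq B) : R := \prod_(b <- s) p b.

Lemma code_bounds s :
  [/\ 0 <= code_left s, 0 <= code_width s & code_left s + code_width s <= 1].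
Proof.
elim: s => [|b s [l0 w0 lw]]; rewrite /code_width /= ?big_nil ?big_cons.
  by split => //; rewrite add0r.
rewrite -/(code_width s); split.
- by rewrite addr_ge0 ?mulr_ge0// cumul_ge0.
- by rewrite mulr_ge0.
- rewrite -addrA -mulrDr (le_trans _ (cumul_le1 b))// lerD2l.
  by rewrite -[leRHS]mulr1 ler_wpM2l.
Qed.

(** Prefixing s by b maps its interval affinely into the interval of b. *)
Lemma codeP s t : 0 <= t < 1 ->
  (forall i, (i < size s)%N -> branch (iter i expand t) = nth b0 s i) <->
  code_left s <= t < code_left s + code_width s.
Proof.
elim: s t => [|b s IH] t t01.
  by rewrite /code_width big_nil add0r; split.
have [l0 w0 lw] := code_bounds s.
rewrite /code_width big_cons -/(code_width s) /=.
have -> : (forall i, (i < (size s).+1)%N ->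
      branch (iter i expand t) = nth b0 (b :: s) i) <->
    branch t = b /\ forall i, (i < size s)%N ->
      branch (iter i expand (expand t)) = nth b0 s i.
  split=> [h|[h0 h] [|i]//=].
    split; first exact: (h 0%N).
    by move=> i si; rewrite -iterSr; exact: (h i.+1).
  by rewrite ltnS -iterS iterSr; exact: h.
split.
  move=> [bt /(IH _ (expand_itv t01))].
  have := branchP t01; rewrite /expand bt => /andP[h1 h2].
  have pb : 0 < p b by lra.
  by rewrite ler_pdivlMr// ltr_pdivrMr// => /andP[h3 h4]; apply/andP; split; lra.
move=> /andP[h1 h2].
have bt : branch t = b.
  apply: branchE; have := mulr_ge0 (p0 b) l0.
  have := ler_wpM2l (p0 b) lw; rewrite mulr1 mulrDr => *.
  by apply/andP; split; lra.
split => //; apply/IH; first exact: expand_itv.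
have := branchP t01; rewrite /expand bt => /andP[h3 h4].
have pb : 0 < p b by lra.
by rewrite ler_pdivlMr// ltr_pdivrMr//; apply/andP; split; lra.
Qed.

(** Outside [0, 1), a set of measure zero, the code takes the default value b0.
    *)
Definition code (n : nat) (t : R) : B :=
  if 0 <= t < 1 then branch (iter n expand t) else b0.

Lemma code_block k (u : {ffun 'I_k -> B}) :
  (fun t => [ffun i : 'I_k => code i t]) @^-1` [set u] `&` `[0%R, 1%R[%classic =
  `[code_left (codom u), (code_left (codom u) + code_width (codom u))[%classic.
Proof.
have [l0 w0 lw] := code_bounds (codom u).
have sz : size (codom u) = k by rewrite size_codom card_ord.
apply/seteqP; split => t /=; rewrite !in_itv/=.
  move=> [ut t01]; apply/(codeP _ t01) => i; rewrite sz => ik.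
  rewrite -ut (nth_map (Ordinal ik)) ?size_enum_ord// ffunE /code t01.
  by rewrite nth_enum_ord.
move=> tw; have t01 : 0 <= t < 1 by case/andP: tw; lra.
split=> //; apply/ffunP => i; rewrite ffunE /code t01.
have /(codeP _ t01) -> := tw; last by rewrite sz.
by rewrite (nth_map i) ?size_enum_ord// nth_ord_enum.
Qed.

Lemma fvm_code n : finite_valued_measurable (code n : measurableTypeR R -> B).
Proof.
have mK : finite_valued_measurable (fun t : measurableTypeR R => if 0 <= (t : R) < 1
    then Some [ffun i : 'I_n.+1 => code i t] else None).
  move=> [u|].
    rewrite [X in measurable X](_ : _ = `[code_left (codom u),
        (code_left (codom u) + code_width (codom u))[%classic) //.
    rewrite -code_block; apply/seteqP; split => t /=; rewrite in_itv/=.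
      by case: ifP => // t01 [].
    by move=> [<- ->].
  rewrite [X in measurable X](_ : _ = ~` `[0%R, 1%R[%classic).
    exact: measurableC.
  apply/seteqP; split => t /=; rewrite in_itv/=; first by case: ifP.
  by move=> /negP/negbTE ->.
have -> : code n =
    (fun o : option {ffun 'I_n.+1 -> B} => if o is Some u then u ord_max else b0) \o
    (fun t : measurableTypeR R => if 0 <= (t : R) < 1
    then Some [ffun i : 'I_n.+1 => code i t] else None).
  apply/funext => t /=; rewrite {1}/code; case: ifP => // t01.
  by rewrite ffunE /code t01.
exact: fvm_comp.
Qed.

Lemma law_code k (u : {ffun 'I_k -> B}) :
  law (@unit_lebesgue R) (fun t => [ffun i : 'I_k => code i t]) u =
  \prod_i p (u i).
Proof.
rewrite /law /= /unit_lebesgue /mrestr code_block lebesgue_measure_itv/=.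
have [l0 w0 lw] := code_bounds (codom u).
rewrite lte_fin ltrDl lt_neqAle w0 andbT.
transitivity (code_width (codom u)).
  case: ifPn => [_|]; first by rewrite -EFinD/= addrAC subrr add0r.
  by rewrite negbK => /eqP <-.
by rewrite /code_width big_map big_enum.
Qed.

End interval_coding.

(** Lebesgue measure on [0, 1) gives to each finite block of the coded sequence
    the length of its interval, a product of weights. The statement is for
    blocks at any starting time s, which makes the stationarity of the sequence
    explicit. *)
Lemma bernoulli_process (R : realType) (B : finType) (p : B -> R) :
  (forall b, 0 <= p b) -> \sum_b p b = 1 ->
  exists (disp : measure_display) (X : measurableType disp)
    (P : probability X R) (Y : nat -> X -> B),
    (forall i, finite_valued_measurable (Y i)) /\
    forall s k (u : {ffun 'I_k -> B}),
      law P (fun x => [ffun i : 'I_k => Y (s + i)%N x]) u = \prod_i p (u i).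
Proof.
move=> p0 p1.
have /existsP[b0 _] : [exists b, p b != 0].
  apply: contra_eqT p1; rewrite negb_exists => /forallP h.
  rewrite big1 ?(eq_sym 0) ?oner_eq0// => b _.
  by have := h b; rewrite negbK => /eqP.
exists _, (measurableTypeR R), (@unit_lebesgue R), (code p b0).
split => [i|s k u]; first exact: fvm_code.
(* Constrains the last k of the first s + k symbols to be u, so that the marginal
   law becomes a sum of products over all sequences of length s + k. *)
pose chi (j : 'I_(s + k)) (b : B) : R :=
  if fintype.split j is inr i then (b == u i)%:R else 1.
pose g (v : {ffun 'I_(s + k) -> B}) := [ffun i : 'I_k => v (rshift s i)].
have := law_comp (@unit_lebesgue R) g u
  (fvm_ffun (fun i : 'I_(s + k) => @fvm_code R B p b0 p0 p1 i)).
have -> : g \o (fun x : R => [ffun i : 'I_(s + k) => code p b0 i (x : R)]) =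
    fun x => [ffun i : 'I_k => code p b0 (s + i) x].
  by apply/funext => x; apply/ffunP => i; rewrite !ffunE.
move=> ->.
rewrite (eq_bigr (fun v : {ffun 'I_(s + k) -> B} => \prod_i p (v i))); last first.
  by move=> v _; exact: law_code.
rewrite big_mkcond/=.
rewrite (eq_bigr (fun v : {ffun 'I_(s + k) -> B} => \prod_j (p (v j) * chi j (v j)))).
  rewrite -(bigA_distr_bigA (fun j b => p b * chi j b)) big_split_ord/=.
  rewrite big1 ?mul1r; last first.
    move=> j _; rewrite -[RHS]p1; apply: eq_bigr => b _; rewrite /chi.
    case: splitP => [? _|i /= ij]; first by rewrite mulr1.
    by have := ltn_ord j; rewrite ij ltnNge leq_addr.
  apply: eq_bigr => i _; rewrite (bigD1 (u i))//= big1 ?addr0; last first.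
    move=> b bu; rewrite /chi; case: splitP => [j /= ij|j /= /addnI/ord_inj <-].
      by have := ltn_ord j; rewrite -ij ltnNge leq_addr.
    by rewrite (negbTE bu) mulr0.
  rewrite /chi; case: splitP => [j /= ij|j /= /addnI/ord_inj <-].
    by have := ltn_ord j; rewrite -ij ltnNge leq_addr.
  by rewrite eqxx mulr1.
move=> v _; rewrite big_split/=.
have chiE (i : 'I_k) : chi (rshift s i) (v (rshift s i)) = (v (rshift s i) == u i)%:R.
  rewrite /chi; case: splitP => [j /= ij|j /= /addnI/ord_inj <-//].
  by have := ltn_ord j; rewrite -ij ltnNge leq_addr.
case: eqP => [gv|gv].
  rewrite [X in _ * X]big1 ?mulr1// => j _.
  rewrite /chi; case: splitP => // i ij.
  have -> : j = rshift s i by exact: val_inj.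
  by rewrite -gv ffunE eqxx.
have [i vi] : exists i : 'I_k, v (rshift s i) != u i.
  apply: contra_notP gv => /forallNP h; apply/ffunP => i; rewrite ffunE.
  by apply/eqP; have := h i; move/negP; rewrite negbK.
by rewrite [X in _ = _ * X](bigD1 (rshift s i))//= chiE (negbTE vi) !mul0r mulr0.
Qed.

(** * Pushforwards, mixtures, and sums over independent letters *)

Lemma pushforward_probability (d1 d2 : measure_display)
    (X : measurableType d1) (X' : measurableType d2) (R : realType)
    (P : probability X R) (f : X -> X') : measurable_fun setT f ->
  exists Q : probability X' R, forall B, Q B = P (f @^-1` B).
Proof.
move=> mf; pose f' : {mfun X >-> X'} := mfun_Sub (mem_set mf).
by exists (distribution P f').
Qed.

Lemma mixture_probability (disp : measure_display) (X : measurableType disp)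
    (R : realType) (n : nat) (c : 'I_n -> R) (Q : 'I_n -> probability X R) :
  (forall j, 0 <= c j) -> \sum_j c j = 1 ->
  exists rho : probability X R,
    forall B, measurable B -> pr rho B = \sum_j c j * pr (Q j) B.
Proof.
move=> c0 c1.
pose m (k : nat) : {measure set X -> \bar R} :=
  if insub k is Some j then mscale (NngNum (c0 j)) (Q j) else mzero.
have msumE B : measurable B -> msum m n B = (\sum_j c j * pr (Q j) B)%:E.
  move=> mB; rewrite /msum -sumEFin; apply: eq_bigr => j _.
  by rewrite /m valK /= /mscale /= EFinM EFin_pr.
have m1 : msum m n setT = 1%E.
  rewrite msumE// -c1; congr EFin; apply: eq_bigr => j _.
  by rewrite /pr probability_setT mulr1.
pose Pm := Measure_isProbability.Build _ _ _ (msum m n) m1.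
pose rho : probability X R := HB.pack (msum m n) Pm.
by exists rho => B mB; exact: (congr1 fine (msumE B mB)).
Qed.

Section iid_sums.
Variables (R : realType) (B : finType) (p : B -> R) (k : nat).
Hypothesis p0 : forall b, 0 <= p b.
Hypothesis p1 : \sum_b p b = 1.
Local Notation wt u := (\prod_(i < k) p (u i)).

(** Distributivity: a product weight integrates products coordinatewise. *)
Lemma sum_iid_prod (f : 'I_k -> B -> R) :
  \sum_(u : {ffun 'I_k -> B}) wt u * \prod_i f i (u i) =
  \prod_i \sum_b p b * f i b.
Proof.
rewrite (bigA_distr_bigA (fun i b => p b * f i b)).
by apply: eq_bigr => u _; rewrite big_split.
Qed.

Lemma sum_iid1 : \sum_(u : {ffun 'I_k -> B}) wt u = 1.
Proof.
have /= := sum_iid_prod (fun _ _ => 1).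
rewrite (eq_bigr (fun u : {ffun 'I_k -> B} => wt u)) => [->|u _]; last first.
  by rewrite [X in _ * X]big1 ?mulr1.
rewrite big1// => i _.
by under eq_bigr do rewrite mulr1.
Qed.

Lemma sum_iid_marginal (i : 'I_k) (f : B -> R) :
  \sum_(u : {ffun 'I_k -> B}) wt u * f (u i) = \sum_b p b * f b.
Proof.
have /= := sum_iid_prod (fun j b => if j == i then f b else 1).
rewrite (eq_bigr (fun u : {ffun 'I_k -> B} => wt u * f (u i))) => [->|u _]; last first.
  rewrite [X in _ * X](bigD1 i)//= eqxx [X in _ * (_ * X)]big1 ?mulr1//.
  by move=> j /negbTE ->.
rewrite (bigD1 i)//= [X in _ * X]big1 ?mulr1; last first.
  move=> j /negbTE ->; rewrite -[RHS]p1.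
  by apply: eq_bigr => b _; rewrite mulr1.
by rewrite eqxx.
Qed.

Lemma sum_iid_orthogonal (i j : 'I_k) (f : B -> R) : i != j ->
  \sum_b p b * f b = 0 ->
  \sum_(u : {ffun 'I_k -> B}) wt u * (f (u i) * f (u j)) = 0.
Proof.
move=> ij f0.
have /= := sum_iid_prod (fun l b => if (l == i) || (l == j) then f b else 1).
rewrite (eq_bigr (fun u : {ffun 'I_k -> B} => wt u * (f (u i) * f (u j)))) => [->|u _]; last first.
  congr (_ * _); rewrite (bigD1 i)//= (bigD1 j)/=; last by rewrite eq_sym.
  rewrite !eqxx orbT /= big1 ?mulr1//.
  by move=> l /andP[/negbTE -> /negbTE ->].
rewrite (bigD1 i)//=.
by rewrite eqxx /= f0 mul0r.
Qed.

Lemma entropy_iid :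
  entropy (fun u : {ffun 'I_k -> B} => wt u) = k%:R * entropy p.
Proof.
rewrite /entropy mulrN; congr (- _).
rewrite (eq_bigr (fun u : {ffun 'I_k -> B} => \sum_i wt u * ln (p (u i)))).
  rewrite exchange_big/= (eq_bigr (fun=> \sum_b p b * ln (p b))).
    by rewrite sumr_const card_ord mulr_natl.
  by move=> i _; exact: (sum_iid_marginal i (fun b => ln (p b))).
move=> u _; rewrite -mulr_sumr.
have [[i /eqP ui]|h] := pselect (exists i, p (u i) == 0).
  by rewrite (bigD1 i)//= ui !mul0r.
congr (_ * _); apply: ln_prod => i; rewrite lt_neqAle p0 andbT eq_sym.
by apply/negP => ui; apply: h; exists i.
Qed.

(** The weak law of large numbers in L1: the distinct coordinates are
    orthogonal, so the variance of the mean is at most M^2 / k, and |z| <= e +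
    z^2 / e. *)
Lemma iid_mean_deviation (f : B -> R) (M e : R) (fb : R := \sum_b p b * f b) :
  (0 < k)%N -> 0 < e -> (forall b, `|f b - fb| <= M) ->
  \sum_(u : {ffun 'I_k -> B}) wt u * `|k%:R^-1 * \sum_i f (u i) - fb| <=
  e + M ^+ 2 / (k%:R * e).
Proof.
move=> k0 e0 fM; have kR : 0 < k%:R :> R by rewrite ltr0n.
pose g b := f b - fb.
have g0 : \sum_b p b * g b = 0.
  under eq_bigr do rewrite mulrBr.
  by rewrite sumrB -mulr_suml p1 mul1r subrr.
have dev (u : {ffun 'I_k -> B}) : k%:R^-1 * \sum_i f (u i) - fb = k%:R^-1 * \sum_i g (u i).
  rewrite /g sumrB sumr_const card_ord mulrBr -(mulr_natl fb).
  by rewrite mulKf// gt_eqF.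
have var : \sum_(u : {ffun 'I_k -> B}) wt u * (\sum_i g (u i)) ^+ 2 <= k%:R * M ^+ 2.
  rewrite (eq_bigr (fun u : {ffun 'I_k -> B} => \sum_i \sum_j wt u * (g (u i) * g (u j)))); last first.
    move=> u _; rewrite expr2 mulr_suml mulr_sumr; apply: eq_bigr => i _.
    by rewrite mulr_sumr mulr_sumr.
  rewrite exchange_big/=.
  apply: (@le_trans _ _ (\sum_(i < k) M ^+ 2)); last first.
    by rewrite sumr_const card_ord mulr_natl.
  apply: ler_sum => i _; rewrite exchange_big/= (bigD1 i)//= [X in _ + X]big1 ?addr0.
    rewrite (sum_iid_marginal i (fun b => g b * g b)).
    rewrite -[leRHS]mul1r -p1 mulr_suml; apply: ler_sum => b _.
    rewrite ler_wpM2l// -expr2 -real_normK ?num_real//.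
    by rewrite lerXn2r// ?nnegrE// ?fM//; exact: le_trans (fM b).
  by move=> j ji; apply: sum_iid_orthogonal => //; rewrite eq_sym.
apply: (@le_trans _ _ (\sum_(u : {ffun 'I_k -> B}) wt u *
    (e + (\sum_i g (u i)) ^+ 2 / (k%:R ^+ 2 * e)))).
  apply: ler_sum => u _; rewrite ler_wpM2l ?prodr_ge0// dev.
  set s := \sum_i g (u i); set z := k%:R^-1 * s.
  have -> : s ^+ 2 / (k%:R ^+ 2 * e) = `|z| ^+ 2 / e.
    by rewrite real_normK ?num_real// /z; field; rewrite !gt_eqF.
  rewrite -(ler_pM2r e0) mulrDl divfK ?gt_eqF//.
  have := normr_ge0 z; set y := `|z| => y0; nra.
under eq_bigr do rewrite mulrDr mulrA.
rewrite big_split/= -!mulr_suml sum_iid1 mul1r lerD2l.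
have -> : M ^+ 2 / (k%:R * e) = k%:R * M ^+ 2 / (k%:R ^+ 2 * e).
  by field; rewrite !gt_eqF.
by rewrite ler_wpM2r// invr_ge0 mulr_ge0 ?exprn_ge0// ltW.
Qed.

End iid_sums.

(** * Observables with bounded distortion *)

Section regular_observables.
Context {R : realType} {d : nat}.
Local Notation Om := (borel_shift R d).
Local Notation T := (@shift_map R d : Om -> Om).
Local Notation fvm := (@finite_valued_measurable _ _ _).

Definition birkhoff_sum (A : Om -> R) (n : nat) (x : Om) : R :=
  \sum_(i < n) A (iter i T x).

(** What is used of a Hoelder potential: a bound M, uniform approximation by
    functions of finitely many letters, and Birkhoff sums over n steps that
    depend on the first n letters up to an error D independent of n. *)
Definition regular (A : Om -> R) (M D : R) : Prop :=
  [/\ forall x, `|A x| <= M,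
      forall e, 0 < e -> exists N, forall x y,
        word N x = word N y -> `|A x - A y| <= e &
      forall n x y, word n x = word n y ->
        `|birkhoff_sum A n x - birkhoff_sum A n y| <= D].

Lemma word_iter_shift i n (x y : Om) : (i <= n)%N ->
  word n x = word n y -> word (n - i) (iter i T x) = word (n - i) (iter i T y).
Proof.
move=> ni /word_eqP xy; apply/word_eqP => j jn.
by rewrite !iter_shift xy// -ltn_subRL.
Qed.

(** After i < n steps the orbits of two points with the same word of length n
    still agree on n - i letters, so the differences along the orbits are
    dominated by a geometric series. *)
Lemma holder_regular (A : shift_space R d -> R) :
  holder A -> exists M D, [/\ 0 < M, 0 <= D & regular A M D].
Proof.
move=> [C [a [a0 a1 HA]]].
pose r : R := 2^-1 `^ a.
have r0 : 0 < r by rewrite powR_gt0.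
have r1 : r < 1.
  have := @gt0_ltr_powR R a a0 2^-1 1; rewrite !nnegrE powR1; apply => //; lra.
have rC n (x y : Om) : word n x = word n y -> `|A x - A y| <= `|C| * r ^+ n.
  move=> xy; apply: (le_trans (HA x y)).
  apply: (@le_trans _ _ (`|C| * mdist (x : shift_space R d) y `^ a)).
    by rewrite ler_wpM2r ?powR_ge0// ler_norm.
  rewrite ler_wpM2l// /r -powR_mulrn ?powR_ge0// -powRrM mulrC powRrM powR_mulrn; last lra.
  rewrite ge0_ler_powR// ?nnegrE; [exact: ltW|exact: shift_dist_ge0|by rewrite exprn_ge0//; lra|].
  rewrite (le_trans (shift_dist_word xy))// exprVn.
  by rewrite lef_pV2 ?posrE ?exprn_gt0// ler_eXn2l// ltr1n.
exists (`|A point| + `|C| + 1), (`|C| / (1 - r)).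
have C0 := normr_ge0 C; have A0 := normr_ge0 (A point).
split; first lra.
  by rewrite divr_ge0//; lra.
split.
- move=> x; have := rC 0%N x point; rewrite expr0 mulr1.
  have -> : word 0 x = word 0 (point : Om) by apply/ffunP => -[].
  move=> /(_ erefl); have := ler_normD (A x - A point) (A point).
  by rewrite subrK; lra.
- move=> e e0.
  have [N rN] := @geometric_lt R r (e / (`|C| + 1)) (ltW r0) r1 ltac:(by rewrite divr_gt0//; lra).
  exists N => x y /rC /le_trans; apply.
  move: rN; rewrite ltr_pdivlMr; last lra.
  have := exprn_ge0 N (ltW r0); set q := _ ^+ _; nra.
- move=> n x y xy; rewrite /birkhoff_sum -sumrB.
  apply: (le_trans (ler_norm_sum _ _ _)).
  apply: (@le_trans _ _ (\sum_(i < n) `|C| * r ^+ (n - i))).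
    by apply: ler_sum => i _; apply: rC; apply: word_iter_shift => //; exact: ltnW.
  rewrite -mulr_sumr ler_wpM2l//.
  rewrite (reindex_inj rev_ord_inj)/=.
  apply: (@le_trans _ _ (\sum_(i < n) r ^+ i)).
    apply: ler_sum => i _; rewrite subKn// exprS.
    by rewrite ger_pMl ?exprn_gt0// ltW.
  have -> : \sum_(i < n) r ^+ i = (1 - r ^+ n) / (1 - r).
    have r1' : 1 - r != 0 by rewrite subr_eq0 gt_eqF.
    elim: n {x y xy} => [|n IH]; first by rewrite big_ord0 expr0 subrr mul0r.
    by rewrite big_ord_recr/= IH exprS; field.
  rewrite -[leRHS]mul1r ler_wpM2r ?invr_ge0//; first lra.
  by rewrite lerBlDr lerDl exprn_ge0// ltW.
Qed.

End regular_observables.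

(** * Stationary concatenations of independent blocks *)

Section block_measures.
Context {R : realType} {d : nat}.
Local Notation Om := (borel_shift R d).
Local Notation T := (@shift_map R d : Om -> Om).
Local Notation fvm := (@finite_valued_measurable _ _ _).
Local Notation word := (@word R d).
Local Notation words n := {ffun 'I_n -> 'I_d.+1}.

Definition extend_word n (w : words n) : Om := fun k => oapp w ord0 (insub k).

Lemma extend_wordE n (w : words n) k (kn : (k < n)%N) :
  extend_word w k = w (Ordinal kn).
Proof. by rewrite /extend_word insubT. Qed.

Lemma extend_wordK n (w : words n) : word n (extend_word w) = w.
Proof.
by apply/ffunP => i; rewrite ffunE extend_wordE; congr (w _); apply: val_inj.
Qed.

(** The points following the word are fixed, by padding with the letter 0; the
    choice is immaterial up to the distortion D / n. *)
Definition word_average (A : Om -> R) n (w : words n) : R :=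
  birkhoff_average T A n (extend_word w).

Lemma measurable_regular (A : Om -> R) M D : regular A M D ->
  measurable_fun setT A.
Proof.
move=> [_ cA _]; apply: measurable_fun_local => x e e0.
have [N AN] := cA (e / 2) ltac:(lra).
exists N => y /AN h; apply: (le_lt_trans h); lra.
Qed.

Lemma integrable_regular (rho : probability Om R) (A : Om -> R) M D :
  regular A M D -> rho.-integrable setT (EFin \o A).
Proof.
move=> rA; apply: measurable_bounded_integrable => //.
- exact: (le_lt_trans (probability_le1 rho measurableT) (ltry _)).
- exact: (measurable_regular rA).
- case: rA => AM _ _; exists M; split; first exact: num_real.
  by move=> M' /ltW MM' x _; apply: le_trans MM'; exact: AM.
Qed.

Lemma birkhoff_average_le (A : Om -> R) M D n x : regular A M D -> 0 <= M ->
  `|birkhoff_average T A n x| <= M.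
Proof.
move=> [AM _ _] M0; rewrite /birkhoff_average normrM ger0_norm ?invr_ge0//.
case: n => [|n]; first by rewrite big_ord0 normr0 mulr0.
rewrite mulrC ler_pdivrMr ?ltr0n// (le_trans (ler_norm_sum _ _ _))//.
apply: (@le_trans _ _ (\sum_(i < n.+1) M)); first exact: ler_sum.
by rewrite sumr_const card_ord mulr_natr.
Qed.

Lemma birkhoff_average_distortion (A : Om -> R) M D n (x y : Om) :
  regular A M D -> word n x = word n y ->
  `|birkhoff_average T A n x - birkhoff_average T A n y| <= D / n%:R.
Proof.
move=> [_ _ AD] xy; rewrite -mulrBr normrM ger0_norm ?invr_ge0// mulrC.
by rewrite ler_wpM2r ?invr_ge0// AD.
Qed.

Lemma Rintegral_word (A : Om -> R) M D (e : R) :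
  regular A M D -> 0 < e -> exists N,
  (forall x, `|A x - A (extend_word (word N x))| <= e) /\
  forall rho : probability Om R,
  `|\int[rho]_x A x - \sum_w law rho (word N) w * A (extend_word w)| <= e.
Proof.
move=> rA e0; have [_ cA _] := rA; have [N AN] := cA e e0.
exists N.
have h x : `|A x - A (extend_word (word N x))| <= e.
  by apply: AN; rewrite extend_wordK.
split => // rho; apply: (@ler_norm_Rintegral_law _ _ _ rho _ (word N) A (fun w => A (extend_word w))).
- exact: fvm_word.
- exact: measurable_regular rA.
- exact: h.
Qed.

Lemma birkhoff_sumD (A : Om -> R) a b x :
  birkhoff_sum A (a + b) x = birkhoff_sum A a x + birkhoff_sum A b (iter a T x).
Proof.
rewrite /birkhoff_sum big_split_ord/=; congr (_ + _).
by apply: eq_bigr => i _; rewrite addnC iterD.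
Qed.

Lemma birkhoff_sum_blocks (A : Om -> R) m k x :
  birkhoff_sum A (m * k) x = \sum_(i < k) birkhoff_sum A m (iter (m * i) T x).
Proof.
elim: k => [|k IH]; first by rewrite muln0 big_ord0 /birkhoff_sum big_ord0.
by rewrite mulnSr birkhoff_sumD big_ord_recr/= IH.
Qed.

Lemma birkhoff_sum_le (A : Om -> R) M D n x : regular A M D ->
  `|birkhoff_sum A n x| <= n%:R * M.
Proof.
move=> [AM _ _]; rewrite (le_trans (ler_norm_sum _ _ _))//.
apply: (@le_trans _ _ (\sum_(i < n) M)); first exact: ler_sum.
by rewrite sumr_const card_ord mulr_natl.
Qed.

(** Cutting the orbit into blocks of length m costs D for each block. The at
    most m steps by which the k blocks exceed n are counted twice: once in the
    Birkhoff sum, once in the normalisation. *)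
Lemma birkhoff_average_blocks (A : Om -> R) M D m k n x :
  regular A M D -> 0 <= M -> 0 <= D -> (0 < m)%N -> (0 < n)%N ->
  (n <= m * k)%N -> (m * k <= n + m)%N ->
  `|birkhoff_average T A n x -
    k%:R^-1 * \sum_(i < k) word_average A (word m (iter (m * i) T x))| <=
  D / m%:R + (D + 2 * m%:R * M) / n%:R.
Proof.
move=> rA M0 D0 m0 n0 nk kn.
have mR : 0 < m%:R :> R by rewrite ltr0n.
have nR : 0 < n%:R :> R by rewrite ltr0n.
have k0 : (0 < k)%N by lia.
have kR : 0 < k%:R :> R by rewrite ltr0n.
set a := fun i : nat => word_average A (word m (iter (m * i) T x)).
set s := k%:R^-1 * _.
have aM i : `|a i| <= M by exact: (birkhoff_average_le m _ rA M0).
have sE : \sum_(i < k) a i = k%:R * s by rewrite mulVKf// gt_eqF.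
have sM : `|s| <= M.
  rewrite normrM ger0_norm ?invr_ge0// mulrC ler_pdivrMr//.
  rewrite (le_trans (ler_norm_sum _ _ _))//.
  apply: (@le_trans _ _ (\sum_(i < k) M)).
    by apply: ler_sum => i _; exact: aM.
  by rewrite sumr_const card_ord -(mulr_natr M).
have h1 : `|birkhoff_sum A (m * k) x - m%:R * (k%:R * s)| <= k%:R * D.
  rewrite birkhoff_sum_blocks -sE mulr_sumr -sumrB (le_trans (ler_norm_sum _ _ _))//.
  apply: (@le_trans _ _ (\sum_(i < k) D)); last first.
    by rewrite sumr_const card_ord mulr_natl.
  apply: ler_sum => i _.
  rewrite /a /word_average /birkhoff_average mulVKf ?gt_eqF//.
  by case: rA => _ _ AD; apply: AD; rewrite extend_wordK.
have [r rE] : exists r, (m * k = n + r)%N by exists (m * k - n)%N; lia.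
have rm : (r <= m)%N by lia.
have rmR : r%:R <= m%:R :> R by rewrite ler_nat.
have h2 : `|birkhoff_sum A (m * k) x - birkhoff_sum A n x| <= m%:R * M.
  rewrite rE birkhoff_sumD addrC addKr.
  by rewrite (le_trans (birkhoff_sum_le _ _ rA))// ler_wpM2r.
have h3 : `|m%:R * (k%:R * s) - n%:R * s| <= m%:R * M.
  rewrite mulrA -natrM rE natrD mulrDl addrC addKr normrM ger0_norm//.
  by apply: ler_pM.
have kD : k%:R * D <= n%:R * (D / m%:R) + D.
  have -> : n%:R * (D / m%:R) + D = (n + m)%:R * (D / m%:R).
    by rewrite natrD; field; rewrite gt_eqF.
  have -> : k%:R * D = (m * k)%:R * (D / m%:R) by rewrite natrM; field; rewrite gt_eqF.
  by rewrite ler_wpM2r ?divr_ge0// ler_nat.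
have -> : birkhoff_average T A n x - s = n%:R^-1 * (birkhoff_sum A n x - n%:R * s).
  by rewrite mulrBr mulKf// gt_eqF.
rewrite normrM ger0_norm ?invr_ge0// mulrC ler_pdivrMr//.
have -> : (D / m%:R + (D + 2 * m%:R * M) / n%:R) * n%:R =
    n%:R * (D / m%:R) + D + 2 * (m%:R * M).
  by field; rewrite !gt_eqF.
rewrite (le_trans (ler_distD (birkhoff_sum A (m * k) x) _ _))//.
rewrite distrC.
have := ler_distD (m%:R * (k%:R * s)) (birkhoff_sum A (m * k) x) (n%:R * s).
lra.
Qed.

(** If rho is the average of the laws of the first m shifts of phi, integrating
    A against rho amounts to averaging the Birkhoff average of length m along
    phi, which the first word of length m determines up to D / m. *)
Lemma Rintegral_word_average (disp : measure_display) (X : measurableType disp)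
    (P : probability X R) (phi : X -> Om) (rho : probability Om R)
    (A : Om -> R) M D m :
  regular A M D -> (0 < m)%N -> (forall n, fvm (word n \o phi)) ->
  (forall n w, law rho (word n) w =
    \sum_(j < m) m%:R^-1 * law P (word n \o (iter j T \o phi)) w) ->
  `|\int[rho]_x A x - \sum_w law P (word m \o phi) w * word_average A w| <=
  D / m%:R.
Proof.
move=> rA m0 mphi lawE.
apply/ler_addgt0Pr => e e0.
have [N [AN /(_ rho) SN]] := Rintegral_word rA (ltac:(lra) : 0 < e / 2).
set S := \sum_w law rho (word N) w * _ in SN.
(* A word of length N + m determines the words of length N read at the times j < m. *)
pose V := word (N + m) \o phi.
have mV : fvm V by exact: mphi.
pose S' (v : words (N + m)) : R :=
  m%:R^-1 * \sum_(j < m) A (extend_word (word N (iter j T (extend_word v)))).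
have SE : S = \sum_v law P V v * S' v.
  rewrite /S; under eq_bigr do rewrite lawE mulr_suml.
  rewrite exchange_big/=.
  rewrite (eq_bigr (fun j : 'I_m => \sum_v law P V v * (m%:R^-1 *
      A (extend_word (word N (iter j T (extend_word v))))))).
    rewrite exchange_big/=; apply: eq_bigr => v _.
    by rewrite -mulr_sumr -mulr_sumr.
  move=> j _.
  rewrite -(law_map P (fun v => word N (iter j T (extend_word v)))
    (fun w => m%:R^-1 * A (extend_word w)) mV).
  have -> : (fun v => word N (iter j T (extend_word v))) \o V =
      word N \o (iter j T \o phi).
    apply/funext => t /=.
    apply: (@word_eq_le _ _ N (N + m - j)); first by have := ltn_ord j; lia.
    apply: word_iter_shift; last by rewrite extend_wordK.
    by have := ltn_ord j; lia.
  by apply: eq_bigr => w _; ring.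
have pE : \sum_w law P (word m \o phi) w * word_average A w =
    \sum_v law P V v * word_average A (word m (extend_word v)).
  rewrite -(law_map P (fun v => word m (extend_word v)) (@word_average A m) mV).
  have -> : (fun v => word m (extend_word v)) \o V = word m \o phi.
    apply/funext => t /=; apply: (word_eq_le (leq_addl N m)).
    by rewrite extend_wordK.
  by [].
have SS : `|S - \sum_w law P (word m \o phi) w * word_average A w| <= e / 2 + D / m%:R.
  rewrite SE pE -sumrB (le_trans (ler_norm_sum _ _ _))//.
  apply: (@le_trans _ _ (\sum_v law P V v * (e / 2 + D / m%:R))); last first.
    by rewrite -mulr_suml sum_law// mul1r.
  apply: ler_sum => v _.
  rewrite -mulrBr normrM ger0_norm ?law_ge0// ler_wpM2l ?law_ge0//.
  set x := extend_word v.
  apply: (le_trans (ler_distD (birkhoff_average T A m x) _ _)); apply: lerD.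
    rewrite /S' /birkhoff_average -mulrBr -sumrB normrM ger0_norm ?invr_ge0//.
    rewrite mulrC ler_pdivrMr ?ltr0n// (le_trans (ler_norm_sum _ _ _))//.
    apply: (@le_trans _ _ (\sum_(j < m) e / 2)).
      by apply: ler_sum => j _; rewrite distrC.
    by rewrite sumr_const card_ord -(mulr_natr (e / 2)).
  by apply: birkhoff_average_distortion rA _; rewrite extend_wordK.
apply: (le_trans (ler_distD S _ _)); lra.
Qed.

Section block_process.
Variables (m : nat) (m0 : (0 < m)%N) (p : words m -> R).
Hypothesis p0 : forall w, 0 <= p w.
Hypothesis p1 : \sum_w p w = 1.
Context {disp : measure_display} {X : measurableType disp}.
Variables (P : probability X R) (Y : nat -> X -> words m).
Hypothesis mY : forall i, fvm (Y i).
Hypothesis iidY : forall s k (u : {ffun 'I_k -> words m}),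
  law P (fun x => [ffun i : 'I_k => Y (s + i)%N x]) u = \prod_i p (u i).

(** The infinite sequence obtained by writing the blocks one after the other,
    entered at position j. *)
Definition concat_blocks (j : nat) (t : X) : Om := fun n =>
  Y ((n + j) %/ m)%N t (Ordinal (ltn_pmod (n + j) m0)).

Lemma fvm_concat_coord j n : fvm (fun t => concat_blocks j t n).
Proof.
exact: (@fvm_comp _ X _ _ (Y ((n + j) %/ m)%N)
  (fun u : words m => u (Ordinal (ltn_pmod (n + j) m0)))).
Qed.

Lemma measurable_concat_blocks j : measurable_fun setT (concat_blocks j).
Proof. by apply: measurable_fun_shift_space => n; exact: fvm_concat_coord. Qed.

Lemma fvm_word_concat n j : fvm (word n \o concat_blocks j).
Proof.
move=> w; rewrite comp_preimage -[X in measurable X]setTI.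
by apply: measurable_concat_blocks => //; exact: fvm_word.
Qed.

Lemma iter_shift_concat i j t : iter i T (concat_blocks j t) = concat_blocks (i + j) t.
Proof.
apply/funext => n; rewrite iter_shift /concat_blocks.
by have -> : (i + n + j = n + (i + j))%N by lia.
Qed.

(** Subtraction of natural numbers is truncated, hence the second alternative,
    in which the entry lies before the starting position s. *)
Lemma concat_block_entry s i t (l : 'I_m) :
  concat_blocks s t (m * i + l - s)%N = Y i t l \/ (m * i + l < s)%N.
Proof.
case: (ltnP (m * i + l) s) => h; [by right|left].
rewrite /concat_blocks; have E : (m * i + l - s + s = m * i + l)%N by lia.
have -> : ((m * i + l - s + s) %/ m = i)%N.
  by rewrite E mulnC divnMDl// divn_small// addn0.
congr (Y _ _ _); apply: val_inj => /=.
by rewrite E mulnC modnMDl modn_small.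
Qed.

(** The decoding map g does not depend on the starting block s, so the laws of
    the words starting at different blocks coincide. *)
Lemma word_concat_function n k : (n <= m * k)%N ->
  exists g : {ffun 'I_k -> words m} -> words n, forall s t,
    word n (concat_blocks (m * s) t) = g [ffun i : 'I_k => Y (s + i)%N t].
Proof.
move=> nk.
exists (fun v : {ffun 'I_k -> words m} => [ffun i : 'I_n =>
  if (insub (i %/ m)%N : option 'I_k) is Some q
  then v q (Ordinal (ltn_pmod i m0)) else ord0]) => s t.
apply/ffunP => i; rewrite !ffunE.
have ik : (i %/ m < k)%N by rewrite ltn_divLR// mulnC (leq_trans (ltn_ord i)).
rewrite insubT ffunE /concat_blocks /=.
have -> : ((i + m * s) %/ m = s + i %/ m)%N by rewrite addnC mulnC divnMDl.
congr (Y _ _ _); apply: val_inj => /=.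
by rewrite addnC mulnC modnMDl.
Qed.

Lemma law_word_concat_shift n s :
  law P (word n \o concat_blocks (m * s)) = law P (word n \o concat_blocks 0).
Proof.
have nk : (n <= m * n)%N by rewrite leq_pmull.
have [g gE] := word_concat_function nk.
have gs s' : word n \o concat_blocks (m * s') =
    g \o (fun t => [ffun i : 'I_n => Y (s' + i)%N t]).
  by apply/funext => t; rewrite /= gE.
have := gs 0%N; rewrite muln0 => ->; rewrite gs.
apply/funext => w; rewrite !law_comp; [|exact: fvm_ffun|exact: fvm_ffun].
by apply: eq_bigr => u _; rewrite !iidY.
Qed.

(** The blocks s, ..., s + k - 1 are entirely visible in the word, so the word
    carries at least their entropy, which is k times that of one block. *)
Lemma entropy_word_concat n j s k : (j <= m * s)%N -> (m * (s + k) <= n + j)%N ->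
  k%:R * entropy p <= entropy (law P (word n \o concat_blocks j)).
Proof.
move=> js kn; rewrite -(entropy_iid k p0 p1).
pose g (w : words n) : {ffun 'I_k -> words m} :=
  [ffun i : 'I_k => [ffun l : 'I_m => extend_word w (m * (s + i) + l - j)%N]].
have -> : (fun u : {ffun 'I_k -> words m} => \prod_i p (u i)) =
    law P (g \o (word n \o concat_blocks j)).
  apply/funext => u; rewrite -(iidY s); congr (law P _ u).
  apply/funext => t; apply/ffunP => i; rewrite !ffunE; apply/ffunP => l.
  rewrite ffunE /=.
  have lt1 : (m * (s + i) + l - j < n)%N.
    by have := ltn_ord i; have := ltn_ord l; nia.
  rewrite extend_wordE ffunE /=.
  have [->//|] := concat_block_entry j (s + i) t l.
  by rewrite ltnNge => /negP[]; have := ltn_ord l; nia.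
by apply: entropy_law_comp; exact: fvm_word_concat.
Qed.

Lemma law_block u : law P (word m \o concat_blocks 0) u = p u.
Proof.
have -> : word m \o concat_blocks 0 =
    (fun v : {ffun 'I_1 -> words m} => v ord0) \o
    (fun t => [ffun i : 'I_1 => Y (0 + i)%N t]).
  apply/funext => t; apply/ffunP => l; rewrite !ffunE /=.
  have [E|//] := concat_block_entry 0 0 t l.
  rewrite muln0 add0n subn0 in E.
  by rewrite E ffunE.
rewrite law_comp; last by apply: fvm_ffun.
rewrite (bigD1 [ffun=> u])/=; last by rewrite ffunE.
rewrite iidY big_ord1 ffunE big1 ?addr0// => v /andP[/eqP <- /eqP[]].
by apply/ffunP => i; rewrite ffunE ord1.
Qed.

End block_process.

(** Concatenate independent blocks of law p and average over the m possible
    starting positions. Shifting moves each position to the next, and the last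
    one to the first up to a shift of the blocks, so the average is invariant.
    By concavity the entropy of its words is at least the average of the
    entropies over the starting positions, each of which is at least that of k
    independent blocks. *)
Lemma block_measure (A : Om -> R) M D m (p : words m -> R) :
  regular A M D -> (0 < m)%N -> (forall w, 0 <= p w) -> \sum_w p w = 1 ->
  exists rho : probability Om R,
    [/\ invariant_probability T rho,
        `|\int[rho]_x A x - \sum_w p w * word_average A w| <= D / m%:R &
        forall k, k%:R * entropy p <= entropy (law rho (word (m * k.+1)))].
Proof.
move=> rA m0 p0 p1.
have [disp [X [P [Y [mY iidY]]]]] := bernoulli_process p0 p1.
pose phi := concat_blocks m0 Y.
have mphi j : measurable_fun setT (phi j) by exact: measurable_concat_blocks.
pose Q j := projT1 (cid (pushforward_probability P (mphi j))).
have QE j B : Q j B = P (phi j @^-1` B).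
  exact: (projT2 (cid (pushforward_probability P (mphi j)))).
have mR0 : (m%:R : R) != 0 by rewrite pnatr_eq0 -lt0n.
have [rho rhoE] := @mixture_probability _ _ _ m (fun=> m%:R^-1)
  (fun j => Q j) (fun=> ltac:(by rewrite invr_ge0))
  ltac:(by rewrite sumr_const card_ord -(mulr_natl m%:R^-1) divff).
have lawE (I : finType) (Z : Om -> I) : fvm Z -> law rho Z =
    fun i => \sum_(j < m) m%:R^-1 * law P (Z \o phi j) i.
  move=> mZ; apply/funext => i; rewrite {1}/law -/(pr rho _) rhoE//.
  by apply: eq_bigr => j _; rewrite /pr QE.
have lawT n : law rho (word n \o T) = law rho (word n).
  rewrite !lawE; [|exact: fvm_word|exact: (@fvm_iter_shift R d _ _ 1 (fvm_word (n := n)))].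
  apply/funext => w; rewrite -!mulr_sumr; congr (_ * _).
  have E j : (word n \o T) \o phi j = word n \o phi j.+1.
    apply/funext => t; congr (word n _); exact: (iter_shift_concat m0 Y 1 j t).
  under eq_bigr do rewrite E.
  have : \sum_(j < m.+1) law P (word n \o phi j) w = law P (word n \o phi 0%N) w +
      \sum_(j < m) law P (word n \o phi j.+1) w by rewrite big_ord_recl.
  rewrite big_ord_recr/=.
  have -> : law P (word n \o phi m) w = law P (word n \o phi 0%N) w.
    by have := law_word_concat_shift m0 mY iidY n 1; rewrite muln1 => ->.
  by rewrite addrC => /addrI.
exists rho; split.
- move=> B mB.
  have mT := measurable_shift (R := R) (d := d).
  have [Q' Q'E] := pushforward_probability rho mT.
  rewrite -Q'E; apply: shift_measure_unique => // n w.
  by rewrite -lawT /law Q'E.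
- have -> : \sum_w p w * word_average A w =
      \sum_w law P (word m \o phi 0%N) w * word_average A w.
    by apply: eq_bigr => w _; rewrite (law_block m0 mY iidY).
  apply: (Rintegral_word_average rA m0) => [n|n w]; first exact: fvm_word_concat.
  rewrite lawE; last exact: fvm_word.
  apply: eq_bigr => j _; congr (_ * law P _ w); apply/funext => t /=.
  by rewrite /phi iter_shift_concat addn0.
- move=> k; rewrite lawE; last exact: fvm_word.
  apply: le_trans (entropy_concave _ _ _ _).
  + rewrite -mulr_sumr -(@ler_pM2l _ m%:R) ?ltr0n// mulVKf//.
    apply: (@le_trans _ _ (\sum_(j < m) k%:R * entropy p)).
      by rewrite sumr_const card_ord mulr_natl.
    apply: ler_sum => j _; apply: (entropy_word_concat m0 p0 p1 mY iidY (s := 1)).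
      by rewrite muln1 ltnW.
    by rewrite add1n leq_addr.
  + by move=> j; rewrite invr_ge0.
  + by rewrite sumr_const card_ord -(mulr_natl m%:R^-1) divff.
  + by move=> j w; exact: law_ge0.
  + by move=> j; apply: sum_law; exact: fvm_word_concat.
Qed.

End block_measures.

(** * The nonlinear partition function *)

Section nonlinear_partition_function.
Context {R : realType} {d : nat}.
Local Notation Om := (borel_shift R d).
Local Notation T := (@shift_map R d : Om -> Om).
Local Notation fvm := (@finite_valued_measurable _ _ _).
Local Notation word := (@word R d).
Local Notation words n := {ffun 'I_n -> 'I_d.+1}.
Variables (A : Om -> R) (F : R -> R) (M D L : R).
Hypothesis cF : concave_function F.
Hypothesis rA : regular A M D.
Hypothesis M0 : 0 < M.
Hypothesis D0 : 0 <= D.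
Hypothesis L0 : 0 <= L.
Hypothesis lipF : forall x y, `|x| <= M -> `|y| <= M ->
  `|F x - F y| <= L * `|x - y|.

(** The sum over words that replaces, up to the factor (d + 1)^-n and bounded
    errors in the logarithm, the exponential integral in the definition of the
    nonlinear pressure. *)
Definition partition_sum (n : nat) : R :=
  \sum_(w : words n) expR (n%:R * F (word_average A w)).

Lemma partition_sum_gt0 n : 0 < partition_sum n.
Proof.
rewrite /partition_sum (bigD1 [ffun=> ord0])//= ltr_pwDl ?expR_gt0//.
by apply: sumr_ge0 => w _; exact: expR_ge0.
Qed.

Lemma word_average_le n (w : words n) : `|word_average A w| <= M.
Proof. exact: (birkhoff_average_le n _ rA (ltW M0)). Qed.

Lemma word_average_distortion n (x : Om) : (0 < n)%N ->
  `|n%:R * F (birkhoff_average T A n x) -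
    n%:R * F (word_average A (word n x))| <= L * D.
Proof.
move=> n0; have nR : 0 < n%:R :> R by rewrite ltr0n.
rewrite -mulrBr normrM gtr0_norm//.
have h1 := birkhoff_average_le n x rA (ltW M0).
have h2 := word_average_le (word n x).
have h3 : `|birkhoff_average T A n x - word_average A (word n x)| <= D / n%:R.
  by apply: birkhoff_average_distortion rA _; rewrite extend_wordK.
rewrite (le_trans (ler_wpM2l (ltW nR) (lipF h1 h2)))//.
rewrite mulrCA ler_wpM2l// mulrC -ler_pdivlMr//.
Qed.

Lemma measurable_concave : measurable_fun [set: R] F.
Proof.
apply: continuous_measurable_fun => x.
have M'0 : 0 < `|x| + 1 by rewrite ltr_wpDl.
have [K K0 lipK] := concave_lipschitz cF M'0.
apply/cvgrPdist_le => e e0; near=> y.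
have xy : `|x - y| <= Num.min 1 (e / (K + 1)).
  by near: y; apply: cvgr_dist_le => //; rewrite lt_min ltr01 divr_gt0// ltr_wpDl.
move: xy; rewrite le_min => /andP[xy1 xye].
apply: (le_trans (lipK _ _ _ _)).
- by rewrite lerDl.
- by rewrite -(subKr x y) (le_trans (ler_normB _ _))// lerD2l.
- apply: (le_trans (ler_wpM2l K0 xye)).
  by rewrite mulrA ler_pdivrMr ?ltr_wpDl// mulrC ler_pM2l// lerDl.
Unshelve. all: by end_near. Qed.

Lemma measurable_birkhoff_average n :
  measurable_fun setT (birkhoff_average T A n).
Proof.
apply: measurable_funM; first exact: measurable_cst.
apply: measurable_sum => i; apply: measurableT_comp.
  exact: measurable_regular rA.
exact: measurable_iter_shift.
Qed.

Section uniform_reference_measure.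
Variable mu : probability Om R.
Hypothesis mu_product : uniform_product_measure mu.

Lemma law_uniform n (w : words n) : law mu (word n) w = d.+1%:R ^- n.
Proof.
have := mu_product (fun i : 'I_n => [set w i]%SET).
have -> : [set x : Om | forall i : 'I_n, x i \in [set w i]%SET] =
    word n @^-1` [set w].
  apply/seteqP; split => x /= h.
    by apply/ffunP => i; rewrite ffunE; have := h i; rewrite inE => /eqP.
  by move=> i; rewrite inE -h ffunE.
rewrite /law => ->; rewrite /=.
under eq_bigr do rewrite cards1 mul1r.
by rewrite prodr_const card_ord exprVn.
Qed.

(** On the cylinder of w the exponent n F (A_n x) varies by at most L D, and
    all the cylinders of length n have the same mass. *)
Lemma nonlinear_pressure_partition_sum n : (0 < n)%N ->
  `|n%:R * nonlinear_pressure_seq T mu A F n -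
    (ln (partition_sum n) - n%:R * ln d.+1%:R)| <= L * D.
Proof.
move=> n0; have nR : n%:R != 0 :> R by rewrite pnatr_eq0 -lt0n.
rewrite /nonlinear_pressure_seq mulVKf//.
set f := fun x : Om => expR (n%:R * F (birkhoff_average T A n x)).
pose phi (w : words n) := expR (n%:R * F (word_average A w)).
have phi_f x : expR (- (L * D)) * phi (word n x) <= f x <= expR (L * D) * phi (word n x).
  have := word_average_distortion x n0; rewrite ler_norml => /andP[h1 h2].
  by rewrite -!expRD !ler_expR; apply/andP; split; lra.
have mW : fvm (word n) := @fvm_word R d n.
have If : mu.-integrable setT (EFin \o f).
  apply: measurable_bounded_integrable => //.
  - exact: (le_lt_trans (probability_le1 mu measurableT) (ltry _)).
  - apply: measurableT_comp; first exact: measurable_expR.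
    apply: measurable_funM; first exact: measurable_cst.
    apply: measurableT_comp; first exact: measurable_concave.
    exact: measurable_birkhoff_average.
  - exists (\sum_w expR (L * D) * phi w); split; first exact: num_real.
    move=> K /ltW Kl x _; apply: le_trans Kl.
    rewrite ger0_norm ?expR_ge0//; have /andP[_ +] := phi_f x.
    move=> /le_trans; apply; rewrite (bigD1 (word n x))//= lerDl.
    by apply: sumr_ge0 => w _; rewrite mulr_ge0 ?expR_ge0.
have Iphi c : mu.-integrable setT (EFin \o (fun x => c * phi (word n x))).
  exact: (integrable_fvm mu (fun w => c * phi w) mW).
have Ephi c : \int[mu]_x (c * phi (word n x)) = c * (d.+1%:R ^- n * partition_sum n).
  rewrite (Rintegral_law mu (fun w => c * phi w) mW).
  rewrite /partition_sum mulr_sumr mulr_sumr; apply: eq_bigr => w _.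
  by rewrite law_uniform mulrCA.
set G := d.+1%:R ^- n * partition_sum n in Ephi.
have G0 : 0 < G by rewrite mulr_gt0 ?partition_sum_gt0// invr_gt0 exprn_gt0.
have lnG : ln G = ln (partition_sum n) - n%:R * ln d.+1%:R.
  rewrite lnM ?posrE ?partition_sum_gt0 ?invr_gt0 ?exprn_gt0//.
  by rewrite lnV ?posrE ?exprn_gt0// lnXn// addrC mulr_natl.
have lo : expR (- (L * D)) * G <= \int[mu]_x f x.
  by rewrite -Ephi; apply: le_Rintegral => // x _; case/andP: (phi_f x).
have up : \int[mu]_x f x <= expR (L * D) * G.
  by rewrite -Ephi; apply: le_Rintegral => // x _; case/andP: (phi_f x).
have I0 : 0 < \int[mu]_x f x by apply: lt_le_trans lo; rewrite mulr_gt0 ?expR_gt0.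
rewrite -lnG ler_norml; apply/andP; split.
  have : ln (expR (- (L * D)) * G) <= ln (\int[mu]_x f x).
    by rewrite ler_ln ?posrE//; exact: mulr_gt0 (expR_gt0 _) G0.
  by rewrite lnM ?posrE ?expR_gt0// expRK; lra.
have : ln (\int[mu]_x f x) <= ln (expR (L * D) * G).
  by rewrite ler_ln ?posrE//; exact: mulr_gt0 (expR_gt0 _) G0.
by rewrite lnM ?posrE ?expR_gt0// expRK; lra.
Qed.

End uniform_reference_measure.

Lemma Rintegral_regular_le (rho : probability Om R) : `|\int[rho]_x A x| <= M.
Proof.
apply/ler_addgt0Pr => e e0.
have [N [_ /(_ rho) h]] := Rintegral_word rA e0.
have hM : `|\sum_w law rho (word N) w * A (extend_word w)| <= M.
  rewrite (le_trans (ler_norm_sum _ _ _))//.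
  apply: (@le_trans _ _ (\sum_w law rho (word N) w * M)); last first.
    by rewrite -mulr_suml sum_law ?mul1r//; exact: fvm_word.
  apply: ler_sum => w _; rewrite normrM ger0_norm ?law_ge0// ler_wpM2l ?law_ge0//.
  by case: rA.
set S := \sum_w _ in h hM.
have := ler_normD (\int[rho]_x A x - S) S; rewrite subrK; lra.
Qed.

(** Let p be the Gibbs weights on words of length m. Then ln Z is the p-average
    of m F (word_average) plus the entropy of p. Concavity of F (Jensen) moves
    the average inside F, and [block_measure] provides an invariant probability
    with the same average of A, up to D / m, and with entropy at least that of
    p divided by m. *)
Lemma partition_sum_le m : (0 < m)%N ->
  exists (rho : probability Om R) (l : R),
    [/\ invariant_probability T rho, ks_entropy T rho = l%:E &
        ln (partition_sum m) <= m%:R * (F (\int[rho]_x A x) + l) + L * D].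
Proof.
move=> m0; have mR : 0 < m%:R :> R by rewrite ltr0n.
pose f (w : words m) := m%:R * F (word_average A w).
have [p0 p1 lnZ] := entropy_gibbs_measure f [ffun=> ord0].
set p := (fun w => _ / _) in p0 p1 lnZ.
have [rho [inv iA hrho]] := block_measure rA m0 p0 p1.
have [l [cl lb l0 ld kl]] := word_entropy_rate inv.
exists rho, l; split => //.
have Hp : entropy p <= m%:R * l.
  apply/ler_addgt0Pr => e e0.
  have H0 : 0 <= entropy p by exact: entropy_ge0.
  have [N1 N1P] : exists N, forall n, (N <= n)%N ->
      n%:R^-1 * entropy (law rho (word n)) <= l + e / (2 * m%:R).
    have e'0 : 0 < e / (2 * m%:R) by rewrite divr_gt0// mulr_gt0.
    move/cvgrPdist_le : cl => /(_ _ e'0)[N _ h].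
    by exists N => n /h /=; rewrite ler_norml => /andP[+ _]; lra.
  have [N2 N2P] := @le_mul_large _ (m%:R * l + e / 2) (e / 2) ltac:(lra).
  pose k := maxn N1 N2.
  have n0 : 0 < (m * k.+1)%:R :> R by rewrite ltr0n muln_gt0 m0.
  have kN1 : (N1 <= m * k.+1)%N.
    by rewrite (leq_trans (leq_maxl N1 N2))// (leq_trans (leqnSn _))// leq_pmull.
  have := N1P _ kN1.
  rewrite mulrC ler_pdivrMr// => h1.
  have h2 := hrho k.
  have h3 := N2P k (leq_maxr _ _).
  have : k%:R * entropy p <= k%:R * (m%:R * l + e).
    apply: (le_trans h2); apply: (le_trans h1).
    have -> : (l + e / (2 * m%:R)) * (m * k.+1)%:R =
        k%:R * (m%:R * l + e / 2) + (m%:R * l + e / 2).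
      by rewrite natrM -natr1; field; exact: lt0r_neq0.
    lra.
  rewrite ler_pM2l// ltr0n lt0n; apply/negP => /eqP k0.
  by move: h3; rewrite k0 mul0r; have := mulr_ge0 (ltW mR) l0; lra.
have -> : partition_sum m = \sum_w expR (f w) by [].
rewrite lnZ.
have J : \sum_w p w * f w <= m%:R * F (\sum_w p w * word_average A w).
  rewrite /f; under eq_bigr do rewrite mulrCA.
  by rewrite -mulr_sumr ler_pM2l//; exact: concave_jensen.
have b1 : `|\sum_w p w * word_average A w| <= M.
  rewrite (le_trans (ler_norm_sum _ _ _))//.
  apply: (@le_trans _ _ (\sum_w p w * M)); last by rewrite -mulr_suml p1 mul1r.
  by apply: ler_sum => w _; rewrite normrM (ger0_norm (p0 w));
    exact: ler_wpM2l (p0 w) _ _ (word_average_le w).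
have b2 := Rintegral_regular_le rho.
have := lipF b1 b2; rewrite ler_norml => /andP[_ h4].
have h5 : m%:R * (L * `|\sum_w p w * word_average A w - \int[rho]_x A x|) <= L * D.
  by rewrite mulrCA ler_wpM2l// mulrC -ler_pdivlMr// distrC.
have h6 : m%:R * F (\sum_w p w * word_average A w) <=
    m%:R * (F (\int[rho]_x A x) + L * `|\sum_w p w * word_average A w - \int[rho]_x A x|).
  by rewrite ler_pM2l//; lra.
rewrite mulrDr in h6; rewrite mulrDr; lra.
Qed.

(** The bound must hold for rho not ergodic, whose orbits need not have
    averages close to rho(A). So rho is replaced by independent copies of its
    words of length m, which have almost the same mean and at least the same
    entropy per letter, and for which the law of large numbers concentrates the
    averages. The finite variational principle [entropy_le_energy], applied to
    the words of length n of the concatenation, gives the bound. The length m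
    is fixed first, then the tolerance eta of the law of large numbers, and
    finally n grows. *)
Lemma partition_sum_ge (rho : probability Om R) (l e : R) :
  invariant_probability T rho -> ks_entropy T rho = l%:E -> 0 < e ->
  exists N, forall n, (N <= n)%N ->
    n%:R * (F (\int[rho]_x A x) + l - e) <= ln (partition_sum n).
Proof.
move=> inv kl e0.
have [l' [_ lb l0 _ kl']] := word_entropy_rate inv.
have ll : l' = l by apply: EFin_inj; rewrite -kl' kl.
rewrite {}ll in lb l0.
have [m1 m1P] := @le_mul_large _ (L * (2 * D)) (e / 3) ltac:(lra).
(* The distortion error 2 L D / m is to be at most e / 3. *)
have [m m0 mP] : exists2 m, (0 < m)%N & L * (2 * D) <= m%:R * (e / 3).
  by exists m1.+1 => //; exact: m1P (leqnSn _).
have mR : 0 < m%:R :> R by rewrite ltr0n.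
have L10 : 0 < L + 1 by rewrite ltr_wpDl.
have [eta eta0 etaP] : exists2 eta, 0 < eta & L * eta <= e / 3.
  exists (e / (3 * (L + 1))); first by rewrite divr_gt0// mulr_gt0.
  have -> : L * (e / (3 * (L + 1))) = L / (L + 1) * (e / 3).
    by field; exact: lt0r_neq0.
  by rewrite ler_piMl ?divr_ge0 ?(ltW e0)// ler_pdivrMr// mul1r lerDl.
pose p := law rho (word m).
have p0 w : 0 <= p w by exact: law_ge0.
have p1 : \sum_w p w = 1 by apply: sum_law; exact: fvm_word.
have pl : m%:R * l <= entropy p by exact: lb.
pose a (w : words m) := word_average A w.
pose ab := \sum_w p w * a w.
have abA : `|\int[rho]_x A x - ab| <= D / m%:R.
  apply: (@Rintegral_word_average _ _ _ _ rho id rho A M D m rA m0).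
    by move=> n; exact: fvm_word.
  move=> n w; rewrite -mulr_sumr.
  have E (j : 'I_m) : law rho (word n \o (iter j T \o id)) w = law rho (word n) w.
    by have := law_iter_shift j inv (@fvm_word R d n) => /(congr1 (@^~ w)).
  under eq_bigr do rewrite E.
  by rewrite sumr_const card_ord -(mulr_natl (law _ _ _)) mulKf// gt_eqF.
have ab_le : `|ab| <= M.
  rewrite (le_trans (ler_norm_sum _ _ _))//.
  apply: (@le_trans _ _ (\sum_w p w * M)); last by rewrite -mulr_suml p1 mul1r.
  apply: ler_sum => w _; rewrite normrM (ger0_norm (p0 w)).
  exact: ler_wpM2l (p0 w) _ _ (word_average_le w).
have [disp [X [P [Y [mY iidY]]]]] := bernoulli_process p0 p1.
pose phi : X -> Om := concat_blocks m0 Y 0.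
pose C := L * (2 * D + 2 * m%:R * M) + L * ((2 * M) ^+ 2 * m%:R / eta) + m%:R * l.
have [N NP] := @le_mul_large _ C (e / 3) ltac:(lra).
exists N.+1 => n Nn; have n0 : (0 < n)%N by exact: leq_trans Nn.
have nR : 0 < n%:R :> R by rewrite ltr0n.
have {}NP := NP n (ltnW Nn).
have [k mk nk] : exists2 k, (m * k <= n)%N & (n <= m * k.+1)%N.
  exists (n %/ m)%N; first by rewrite mulnC leq_divM.
  by rewrite mulnC ltnW// ltn_ceil.
have kR : 0 < k.+1%:R :> R by rewrite ltr0n.
pose q := law P (word n \o phi).
have mq : fvm (word n \o phi) by exact: fvm_word_concat.
have q0 w : 0 <= q w by exact: law_ge0.
have q1 : \sum_w q w = 1 by exact: sum_law.
have gibbs_q := entropy_le_energy (fun w => n%:R * F (word_average A w)) q0 q1.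
have Hq : n%:R * l - m%:R * l <= entropy q.
  apply: (@le_trans _ _ (k%:R * entropy p)).
    apply: (@le_trans _ _ (k%:R * (m%:R * l))); last by rewrite ler_wpM2l.
    by rewrite mulrA -natrM -mulrBl ler_wpM2r// lerBlDr -natrD ler_nat mulnC -mulnSr.
  by apply: (entropy_word_concat m0 p0 p1 mY iidY (s := 0)); rewrite ?muln0 ?add0n ?addn0.
have [g gE] := @word_concat_function R d m m0 _ X Y n k.+1 nk.
pose V t : {ffun 'I_k.+1 -> words m} := [ffun i : 'I_k.+1 => Y (0 + i)%N t].
have mV : fvm V := fvm_ffun (fun i : 'I_k.+1 => mY (0 + i)%N).
have gV : word n \o phi = g \o V by apply/funext => t /=; rewrite -gE muln0.
pose s (v : {ffun 'I_k.+1 -> words m}) := k.+1%:R^-1 * \sum_i a (v i).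
pose err := 2 * D / m%:R + (2 * D + 2 * m%:R * M) / n%:R.
have close t : `|word_average A (g (V t)) - s (V t)| <=
    D / m%:R + (2 * D + 2 * m%:R * M) / n%:R.
  have -> : g (V t) = word n (phi t) by exact: esym (congr1 (@^~ t) gV).
  have h1 : `|word_average A (word n (phi t)) -
      birkhoff_average T A n (phi t)| <= D / n%:R.
    by apply: birkhoff_average_distortion rA _; rewrite extend_wordK.
  have kn : (m * k.+1 <= n + m)%N by rewrite mulnSr leq_add2r.
  have h2 := birkhoff_average_blocks (phi t) rA (ltW M0) D0 m0 n0 nk kn.
  have sV : s (V t) = k.+1%:R^-1 *
      \sum_(i < k.+1) word_average A (word m (iter (m * i) T (phi t))).
    congr (_ * _); apply: eq_bigr => i _; congr (word_average A _).
    rewrite /phi iter_shift_concat addn0 ffunE; apply/ffunP => j; rewrite ffunE.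
    have [E|] := @concat_block_entry R d m m0 _ X Y (m * i) i t j.
      by rewrite add0n -E addKn.
    by rewrite ltnNge leq_addr.
  rewrite sV (le_trans (ler_distD (birkhoff_average T A n (phi t)) _ _))//.
  apply: (le_trans (lerD h1 h2)).
  by rewrite le_eqVlt; apply/orP; left; apply/eqP; field; rewrite !gt_eqF.
(* Word averages lie in [-M, M], so they deviate from their mean by at most 2 M. *)
have dev := iid_mean_deviation p0 p1 (k := k.+1) (f := a) (M := 2 * M) (e := eta)
  isT eta0 _.
have {}dev : \sum_v law P V v * `|s v - ab| <= eta + (2 * M) ^+ 2 / (k.+1%:R * eta).
  under eq_bigr do rewrite iidY.
  apply: dev => w; rewrite (le_trans (ler_normB _ _))//.
  have := word_average_le w; rewrite -/(a w) -/ab; lra.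
set FA := F (\int[rho]_x A x).
have EF : FA - L * (err + (eta + (2 * M) ^+ 2 / (k.+1%:R * eta))) <=
    \sum_w q w * F (word_average A w).
  rewrite /q gV law_map//.
  apply: (@le_trans _ _ (\sum_v law P V v * (FA - L * (err + `|s v - ab|)))).
    under [leRHS]eq_bigr do rewrite mulrBr mulrCA mulrDr.
    rewrite sumrB -mulr_suml sum_law// mul1r lerD2l lerN2 -mulr_sumr.
    by rewrite ler_wpM2l// big_split/= -mulr_suml sum_law// mul1r lerD2l.
  apply: ler_sum => v _; have := law_ge0 P V v; rewrite le_eqVlt => /predU1P[<-|v0].
    by rewrite !mul0r.
  (* A block sequence of positive probability is realised by some point t. *)
  have [t Vt] : exists t, V t = v.
    apply: contrapT => /forallNP nV; move: v0; rewrite /law.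
    have -> : V @^-1` [set v] = set0 by apply/seteqP; split => // t /= /nV.
    by rewrite measure0 ltxx.
  rewrite ler_pM2l// -Vt.
  have h1 := close t; have h2 := abA.
  have h3 := lipF (word_average_le (g (V t))) (Rintegral_regular_le rho).
  have h4 : `|word_average A (g (V t)) - \int[rho]_x A x| <= err + `|s (V t) - ab|.
    have d1 := ler_distD (s (V t)) (word_average A (g (V t))) (\int[rho]_x A x).
    have d2 := ler_distD ab (s (V t)) (\int[rho]_x A x).
    rewrite (distrC ab) in d2; rewrite /err mulrDl -mulrA mulrDl mul1r.
    move: h1; rewrite -mulrA; lra.
  have := ler_wpM2l L0 h4; move: h3; rewrite ler_norml -/FA => /andP[+ _]; lra.
have nErr : n%:R * (L * (err + (eta + (2 * M) ^+ 2 / (k.+1%:R * eta)))) <=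
    n%:R * (e / 3 + e / 3) + (C - m%:R * l).
  have -> : n%:R * (L * (err + (eta + (2 * M) ^+ 2 / (k.+1%:R * eta)))) =
     n%:R * (L * (2 * D) / m%:R) + n%:R * (L * eta) + L * (2 * D + 2 * m%:R * M) +
     L * ((2 * M) ^+ 2 * (n%:R / k.+1%:R) / eta).
    rewrite /err; have := kR; move: (k.+1%:R : R) => K K0.
    by field; rewrite (lt0r_neq0 eta0) (lt0r_neq0 K0) (lt0r_neq0 mR) (lt0r_neq0 nR).
  have e1 : n%:R * (L * (2 * D) / m%:R) <= n%:R * (e / 3).
    by rewrite ler_wpM2l// ler_pdivrMr// [leRHS]mulrC.
  have e2 : n%:R * (L * eta) <= n%:R * (e / 3) by rewrite ler_wpM2l.
  have e3 : L * ((2 * M) ^+ 2 * (n%:R / k.+1%:R) / eta) <= L * ((2 * M) ^+ 2 * m%:R / eta).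
    rewrite ler_wpM2l// ler_wpM2r ?invr_ge0 ?(ltW eta0)// ler_wpM2l ?sqr_ge0//.
    by rewrite ler_pdivrMr// -natrM ler_nat.
  have {e1 e2 e3} := lerD (lerD e1 e2) e3; rewrite /C.
  set X1 := n%:R * (L * _ / _); set X2 := n%:R * (L * _).
  set X3 := L * (_ + _); set X4 := L * (_ * _ / eta); set X5 := L * (_ * _ / eta).
  by rewrite [n%:R * (_ + _)]mulrDr; lra.
set dev_err := L * (err + _) in EF nErr.
have nEF : n%:R * (FA - dev_err) <= n%:R * \sum_w q w * F (word_average A w).
  by rewrite ler_pM2l.
have nF : \sum_w q w * (n%:R * F (word_average A w)) =
    n%:R * \sum_w q w * F (word_average A w).
  by rewrite mulr_sumr; apply: eq_bigr => w _; rewrite mulrCA.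
rewrite nF -/(partition_sum n) in gibbs_q.
rewrite mulrBr in nEF; rewrite mulrBr mulrDr.
move: nErr; rewrite [n%:R * (_ + _)]mulrDr => nErr.
have -> : n%:R * e = n%:R * (e / 3) + n%:R * (e / 3) + n%:R * (e / 3).
  by rewrite -!mulrDr; congr (_ * _); field.
clear - nErr nEF gibbs_q Hq NP; lra.
Qed.

End nonlinear_partition_function.

(** * Mixtures of invariant probabilities *)

(** The word entropies are concave in the measure, and their rate is the
    entropy of the shift; thus the set of the pairs (rho(A), h(rho)) is convex
    once closed downwards. *)
Lemma invariant_mixture (R : realType) (d : nat) (A : borel_shift R d -> R)
    (M D : R) (T := @shift_map R d : borel_shift R d -> borel_shift R d)
    (rho1 rho2 : probability (borel_shift R d) R) (l1 l2 t : R) :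
  regular A M D ->
  invariant_probability T rho1 -> ks_entropy T rho1 = l1%:E ->
  invariant_probability T rho2 -> ks_entropy T rho2 = l2%:E ->
  0 <= t -> t <= 1 ->
  exists (rho : probability (borel_shift R d) R) (l : R),
    [/\ invariant_probability T rho, ks_entropy T rho = l%:E,
        \int[rho]_x A x = t * \int[rho1]_x A x + (1 - t) * \int[rho2]_x A x &
        t * l1 + (1 - t) * l2 <= l].
Proof.
move=> rA inv1 k1 inv2 k2 t0 t1.
(* The mixture t rho1 + (1 - t) rho2, as a family indexed by two positions. *)
pose c (j : 'I_2) : R := if j == ord0 then t else 1 - t.
pose Q (j : 'I_2) := if j == ord0 then rho1 else rho2.
have c0 j : 0 <= c j by rewrite /c; case: ifP => // _; lra.
have c1 : \sum_j c j = 1 by rewrite big_ord_recl big_ord1 /c /=; lra.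
have [rho rhoE] := mixture_probability Q c0 c1.
have {}rhoE B : measurable B -> pr rho B = t * pr rho1 B + (1 - t) * pr rho2 B.
  by move=> mB; rewrite rhoE// big_ord_recl big_ord1.
have lawE (I : finType) (Y : borel_shift R d -> I) : finite_valued_measurable Y ->
    law rho Y = fun i => t * law rho1 Y i + (1 - t) * law rho2 Y i.
  by move=> mY; apply/funext => i; exact: rhoE.
have inv : invariant_probability T rho.
  move=> B mB; have mTB : measurable (T @^-1` B).
    by rewrite -[X in measurable X]setTI; exact: measurable_shift.
  by rewrite -!EFin_pr// !rhoE// /pr inv1// inv2.
have [l [cl lb l0 ld kl]] := word_entropy_rate inv.
exists rho, l; split => //.
- apply/eqP; rewrite -subr_eq0 -normr_le0; apply/ler_addgt0Pr => e e0.
  have [N [_ h]] := Rintegral_word rA (ltac:(lra) : 0 < e / 2).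
  have := h rho; rewrite lawE; last exact: fvm_word.
  under eq_bigr do rewrite mulrDl -!mulrA.
  rewrite big_split/= -!mulr_sumr.
  have := h rho1; have := h rho2.
  set S1 := \sum_w _; set S2 := \sum_w _ => h2 h1 h0.
  rewrite add0r; move: h0 h1 h2; rewrite !ler_norml.
  move=> /andP[a1 a2] /andP[b1 b2] /andP[d1 d2].
  have t'0 : 0 <= 1 - t by lra.
  have := ler_wpM2l t0 b1; have := ler_wpM2l t0 b2.
  have := ler_wpM2l t'0 d1; have := ler_wpM2l t'0 d2.
  by move=> *; apply/andP; split; lra.
- have [l1' [_ lb1 _ _ kl1]] := word_entropy_rate inv1.
  have [l2' [_ lb2 _ _ kl2]] := word_entropy_rate inv2.
  have -> : l1 = l1' by apply: EFin_inj; rewrite -kl1 -k1.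
  have -> : l2 = l2' by apply: EFin_inj; rewrite -kl2 -k2.
  rewrite -(cvg_lim _ cl)//; apply: limr_ge; first by apply/cvg_ex; exists l.
  near=> n; have n0 : (0 < n)%N by near: n; exists 1%N.
  have nR : 0 < n%:R :> R by rewrite ltr0n.
  rewrite [leRHS]mulrC ler_pdivlMr//.
  apply: (@le_trans _ _ (t * entropy (law rho1 (@word R d n)) +
      (1 - t) * entropy (law rho2 (@word R d n)))).
    have := ler_wpM2l t0 (lb1 n n0).
    have := ler_wpM2l (ltac:(lra) : 0 <= 1 - t) (lb2 n n0); lra.
  rewrite lawE; last exact: fvm_word.
  have := @entropy_concave R _ _ c (fun j => law (Q j) (@word R d n)) c0 c1.
  rewrite big_ord_recl big_ord1 /=.
  under [X in _ -> _ -> _ <= entropy X]eq_fun do rewrite big_ord_recl big_ord1 /=.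
  apply => [j i|j]; first exact: law_ge0.
  by apply: sum_law; exact: fvm_word.
Unshelve. all: by end_near. Qed.

(** * The variational principle *)

Theorem mainTheorem6 (R : realType) (d : nat)
    (mu : probability (borel_shift R d) R) (A : shift_space R d -> R)
    (F : R -> R)
    (mu_product : uniform_product_measure mu)
    (A_holder : holder A)
    (F_concave : concave_function F)
    (Gstar_superlinear : superlinear (legendre (fun x => - F x))) :
  let T : borel_shift R d -> borel_shift R d := @shift_map R d in
  let G := fun x => - F x in
  [/\ cvgn (nonlinear_pressure_seq T mu A F),
      (nonlinear_pressure T mu A F)%:E =
        ereal_inf (range (fun s : R =>
          legendre G (- s)%R + pressure T (fun x => (s * A x)%R)
          - (ln (d.+1%:R : R))%:E)%E) &
      (nonlinear_pressure T mu A F)%:E =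
        (ereal_sup [set ((F (\int[rho]_x A x)%R)%:E + ks_entropy T rho)%E
                   | rho in @invariant_probability _ (borel_shift R d) R T]
         - (ln (d.+1%:R : R))%:E)%E].
Proof.
move=> T G.
have [M [D [M0 D0 rA]]] := holder_regular A_holder.
have [L L0 lipF] := concave_lipschitz F_concave M0.
have ksE (rho : probability (borel_shift R d) R) : invariant_probability T rho ->
    exists2 l : R, ks_entropy T rho = l%:E & l <= ln d.+1%:R.
  by move=> /word_entropy_rate[l [_ _ _ ld kl]]; exists l.
pose states : set (R * R) := [set z | exists2 rho : probability (borel_shift R d) R,
  invariant_probability T rho &
  z.1 = \int[rho]_x A x /\ ks_entropy T rho = z.2%:E].
have states0 : states !=set0.
  have [rho [l [inv kl _]]] := partition_sum_le F_concave rA M0 L0 lipF (m := 1) isT.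
  by exists (\int[rho]_x A x, l), rho.
have states_norm x l : states (x, l) -> `|x| <= M.
  by move=> [rho _ [/= -> _]]; exact: (Rintegral_regular_le rA).
have states_le x l : states (x, l) -> l <= ln d.+1%:R.
  move=> [rho inv [_ /= kl]]; have [l' kl' ?] := ksE rho inv.
  by have -> : l = l' by apply: EFin_inj; rewrite -kl -kl'.
pose S := [set F z.1 + z.2 | z in states].
have ubS : has_ubound S.
  exists (F 0 + L * M + ln d.+1%:R) => _ [[x l] xl <-] /=.
  apply: lerD; last exact: states_le xl.
  have xM := states_norm _ _ xl.
  have := lipF x 0 xM ltac:(by rewrite normr0 ltW).
  rewrite subr0 => /(le_trans (ler_norm _)) h.
  have := ler_wpM2l L0 xM; lra.
have hS : has_sup S.
  by split => //; have [z zs] := states0; exists (F z.1 + z.2), z.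
pose V := sup S.
have VP x l : states (x, l) -> F x + l <= V.
  by move=> xl; apply: ub_le_sup => //; exists (x, l).
have limp : nonlinear_pressure_seq T mu A F n @[n --> \oo] --> V - ln d.+1%:R.
  apply/cvgrPdist_le => e e0.
  have [N1 N1P] := @le_mul_large _ (2 * (L * D)) (e / 3) ltac:(lra).
  have [_ [[x l] [rho inv [/= xE kl]] <-] /= Vx] := sup_adherent (ltac:(lra) : 0 < e / 3) hS.
  have [N2 N2P] := partition_sum_ge rA M0 D0 L0 lipF inv kl (ltac:(lra) : 0 < e / 3).
  exists (maxn N1 N2).+1 => // n /= Nn.
  have n0 : (0 < n)%N by exact: leq_ltn_trans Nn.
  have nR : 0 < n%:R :> R by rewrite ltr0n.
  have := N1P n (leq_trans (leq_maxl _ _) (ltnW Nn)) => h1.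
  have := N2P n (leq_trans (leq_maxr _ _) (ltnW Nn)); rewrite -xE => h2.
  have [rho' [l' [inv' kl' h3]]] := partition_sum_le F_concave rA M0 L0 lipF n0.
  have := nonlinear_pressure_partition_sum F_concave rA M0 L0 lipF mu_product n0.
  have hV : F (\int[rho']_x A x) + l' <= V by apply: VP; exists rho'.
  have {h3} h3 : ln (partition_sum A F n) <= n%:R * V + L * D.
    by apply: (le_trans h3); rewrite lerD2r ler_pM2l.
  have {h2} h2 : n%:R * (V - e / 3 - e / 3) <= ln (partition_sum A F n).
    by apply: le_trans h2; rewrite ler_pM2l//; rewrite /V; lra.
  have LD0 : 0 <= L * D by rewrite mulr_ge0.
  set p := nonlinear_pressure_seq _ _ _ _ _; rewrite !ler_norml => /andP[h4 h5].
  have up : n%:R * (p - (V - ln d.+1%:R)) <= n%:R * (e / 3) by rewrite !mulrBr; lra.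
  have lo : n%:R * (V - ln d.+1%:R - p) <= n%:R * e.
    have -> : n%:R * e = n%:R * (e / 3) + n%:R * (e / 3) + n%:R * (e / 3).
      by rewrite -!mulrDr; congr (_ * _); field.
    by move: h2; rewrite !mulrBr; lra.
  rewrite ler_pM2l// in up; rewrite ler_pM2l// in lo.
  by apply/andP; split; lra.
have presE : nonlinear_pressure T mu A F = V - ln d.+1%:R by exact: cvg_lim.
have intZ s (rho : probability (borel_shift R d) R) :
    \int[rho]_x (s * A x) = s * \int[rho]_x A x.
  by apply: RintegralZl => //; exact: integrable_regular rA.
split; first by apply/cvg_ex; exists (V - ln d.+1%:R).
- rewrite presE; apply/eqP; rewrite eq_le; apply/andP; split.
    (* Each rho is tested in the pressure, and its mean rho(A) in the conjugate. *)
    apply: le_ereal_inf_tmp => _ [s _ <-]; rewrite EFinB leeD2r//.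
    rewrite -ereal_sup_EFin//; last by case: hS.
    apply: ge_ereal_sup => _ [_ [[x l] [rho inv [/= xE kl]] <-] <-].
    have -> : F x + l = (- s * x - G x) + (s * x + l) by rewrite /G; ring.
    rewrite EFinD; apply: leeD; apply: ereal_sup_ubound; first by exists x.
    by exists rho => //; rewrite kl xE intZ EFinD.
  (* The separating slope is a minimiser. *)
  have [|s sP] := @concave_sandwich R F V states F_concave states0 _ VP.
    move=> x1 l1 x2 l2 t [rho1 inv1 [/= -> kl1]] [rho2 inv2 [/= -> kl2]] t0 t1.
    have [rho [l [inv kl Ax tl]]] := invariant_mixture rA inv1 kl1 inv2 kl2 t0 t1.
    by exists l => //; exists rho.
  pose S1 := range (fun y => - s * y - G y).
  pose S2 := [set s * z.1 + z.2 | z in states].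
  have S12 a b : S1 a -> S2 b -> a + b <= V.
    move=> [y _ <-] [[x l] xl <-] /=; have := sP x l y xl; rewrite /G; lra.
  have S1n : S1 !=set0 by exists (- s * 0 - G 0), 0.
  have S2n : S2 !=set0.
    by have [z zs] := states0; exists (s * z.1 + z.2), z.
  have hS1 : has_ubound S1.
    by have [b bS2] := S2n; exists (V - b) => a aS1; rewrite lerBrDr S12.
  have hS2 : has_ubound S2.
    by have [a aS1] := S1n; exists (V - a) => b bS2; rewrite lerBrDr addrC S12.
  have legE : legendre G (- s) = (sup S1)%:E.
    rewrite -ereal_sup_EFin//; congr ereal_sup; apply/seteqP; split.
      by move=> _ [y _ <-]; exists (- s * y - G y) => //; exists y.
    by move=> _ [_ [y _ <-] <-]; exists y.
  have presSE : pressure T (fun x => s * A x) = (sup S2)%:E.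
    rewrite -ereal_sup_EFin//; congr ereal_sup; apply/seteqP; split.
      move=> _ [rho inv <-]; have [l kl _] := ksE rho inv.
      exists (s * \int[rho]_x A x + l); last by rewrite intZ kl EFinD.
      by exists (\int[rho]_x A x, l) => //; exists rho.
    move=> _ [_ [[x l] [rho inv [/= -> kl]] <-] <-]; exists rho => //.
    by rewrite intZ kl EFinD.
  apply: ge_ereal_inf; eexists; first by exists s.
  rewrite /= legE presSE EFinB leeD2r// -EFinD lee_fin -lerBrDl.
  apply: ge_sup => // b bS2; rewrite lerBrDl -lerBrDr.
  by apply: ge_sup => // a aS1; rewrite lerBrDr S12.
- rewrite presE EFinB; congr (_ - _)%E.
  rewrite -ereal_sup_EFin//; last by case: hS.
  congr ereal_sup; apply/seteqP; split.
    move=> _ [_ [[x l] [rho inv [/= -> kl]] <-] <-]; exists rho => //.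
    by rewrite kl EFinD.
  move=> _ [rho inv <-]; have [l kl _] := ksE rho inv.
  exists (F (\int[rho]_x A x) + l); last by rewrite kl EFinD.
  by exists (\int[rho]_x A x, l) => //; exists rho.
Qed.
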